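(* There exists an absolute constant $C>0$ such that the following holds. Let $\mathcal D$ be any distribution on $[0,1]\times\{0,1\}$, let $T\ge2$, and let $S$ be the uniform distribution over $T$ data points $(p_1,y_1),\ldots,(p_T,y_T)$ drawn i.i.d. from $\mathcal D$. For every $\delta\in(e^{-T/2},1/T)$, with probability at least $1-\delta$, $$|\mathsf{SCDL}(S)-\mathsf{SCDL}(\mathcal D)|\le C\sqrt{\frac{\log(1/\delta)}{T}}\,\log\frac{T}{\ln(1/\delta)}.$$ Moreover, if $\mathsf{SCDL}(\mathcal D)=0$, then for every $\delta\in(e^{-T/2},1/T)$, with probability at least $1-\delta$, $$\mathsf{SCDL}(S)\le C\sqrt{\frac{\log(1/\delta)}{T}\,\log\frac{T}{\ln(1/\delta)}}.$$
   Context: For $x\in\mathbb R$ write $x_+=\max\{x,0\}$. Let $\mathcal D$ be a probability distribution of pairs $(p,y)\in[0,1]\times\{0,1\}$. For a positive integer $m$ and $i\in\{0,\ldots,m\}$ let $w_i(p)=(1-|mp-i|)_+$, $\pi_i=\mathbb E_{(p,y)\sim\mathcal D}[w_i(p)]$ and $q_i=\mathbb E_{(p,y)\sim\mathcal D}[w_i(p)y]/\pi_i$ (equivalently: $p$ is randomly rounded to $p'\in\{0,1/m,\ldots,1\}$ with $\Pr[p'=i/m\mid p]=w_i(p)$, so $\mathbb E[p'\mid p]=p$, and $\pi_i=\Pr[p'=i/m]$, $q_i=\mathbb E[y\mid p'=i/m]$; terms with $\pi_i=0$ are taken to be $0$). Define $$\mathsf{SCDL}_m(\mathcal D)=\max_{i=0,\ldots,m}\Big(\sum_{j=0}^{i}\pi_j\big(q_j-\tfrac{i+1}{m}\big)_+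 +\sum_{j=i+1}^{m}\pi_j\big(\tfrac im-q_j\big)_+\Big),$$ and $\mathsf{SCDL}(\mathcal D)=\inf_{m\in\{2^1,2^2,\ldots\}}\max\{\mathsf{SCDL}_m(\mathcal D),1/m\}$. The same definitions apply to the empirical (uniform) distribution $S$. *)

(* Defs.v *)
From HB Require Import structures.
From mathcomp Require Import all_boot all_order all_algebra.
From mathcomp Require Import all_classical all_reals all_analysis.
Set Implicit Arguments. Unset Strict Implicit. Unset Printing Implicit Defensive.
Import Order.TTheory GRing.Theory Num.Theory.
Local Open Scope classical_set_scope.
Local Open Scope ring_scope.

Section SCDLDefs.
Variable R : realType.

Definition posp (x : R) : R := Num.max x 0.

Definition hatw (m i : nat) (p : R) : R := posp (1 - `|m%:R * p - i%:R|).

(* A distribution of pairs (p,y) is accessed through its expectation functional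
   E : (R * R -> R) -> R, where a pair z has p = z.1 and y = z.2 (y in {0,1}). *)
Definition pi_ (E : (R * R -> R) -> R) (m j : nat) : R := E (fun z => hatw m j z.1).
(* q_j = E[w_j(p) y] / pi_j ; when pi_j = 0 this is 0 (x / 0 = 0 in MathComp),
   and the corresponding term pi_j * (...) vanishes, as the paper stipulates. *)
Definition q_ (E : (R * R -> R) -> R) (m j : nat) : R :=
  E (fun z => hatw m j z.1 * z.2) / pi_ E m j.

(* SCDL_m; the max over i = 0..m of nonnegative quantities (initial value 0 is harmless) *)
Definition SCDL_m (E : (R * R -> R) -> R) (m : nat) : R :=
  \big[Num.max/0]_(i < m.+1)
    ((\sum_(j < m.+1 | (j <= i)%N) pi_ E m j * posp (q_ E m j - i.+1%:R / m%:R))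
   + (\sum_(j < m.+1 | (i < j)%N) pi_ E m j * posp (i%:R / m%:R - q_ E m j))).

Definition SCDL (E : (R * R -> R) -> R) : R :=
  inf [set Num.max (SCDL_m E (2 ^ k.+1)%N) ((2 ^ k.+1)%N%:R)^-1 | k in [set: nat]].

Definition expect_of (D : probability (R * R)%type R) : (R * R -> R) -> R :=
  fun f => Rintegral D setT f.

Definition empirical (T : nat) (x : 'I_T -> R * R) : (R * R -> R) -> R :=
  fun f => (T%:R)^-1 * \sum_(t < T) f (x t).

Definition supported01 (D : probability (R * R)%type R) : Prop :=
  D [set z | 0 <= z.1 <= 1 /\ (z.2 = 0 \/ z.2 = 1)] = 1%E.

(* X_0, ..., X_{T-1} : Omega -> R * R are i.i.d. with law D.
   Mutual independence: product rule for every family of measurable sets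
   (subfamilies are covered by taking B t = setT). *)
Definition iid_sample d (Omega : measurableType d) (P : probability Omega R)
    (T : nat) (X : 'I_T -> Omega -> R * R) (D : probability (R * R)%type R) : Prop :=
  (forall t, measurable_fun setT (X t)) /\
  (forall t (B : set (R * R)), measurable B -> P (X t @^-1` B) = D B) /\
  (forall B : 'I_T -> set (R * R), (forall t, measurable (B t)) ->
     fine (P (\bigcap_(t in [set: 'I_T]) (X t @^-1` B t)))
     = \prod_(t < T) fine (P (X t @^-1` B t))).

End SCDLDefs.

(* Main.v *)
Require Import Defs.
From HB Require Import structures.
From mathcomp Require Import all_boot all_order all_algebra.
From mathcomp Require Import all_classical all_reals all_analysis.
From mathcomp Require Import measurable_realfun ring lra zify.
Import Order.TTheory GRing.Theory Num.Theory.
Local Open Scope classical_set_scope.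
Local Open Scope ring_scope.

(** Write [a_j = pi_j], [u_j = E[w_j y]]; then [SCDL_m] is a maximum over [i] of sums of
    positive parts [(u_j - c a_j)_+], and each term deviates by [sqrt (lambda a_j) + lambda]
    with [lambda = ln (1/delta) / T] (Bernstein). Adding up the [m] deviations naively costs
    [sqrt (m lambda)], which is too much. However the bins [j] at distance about [2^k] from
    [i] satisfy [(c - q_j)_+ + (q_j - (c - 2^k/m))_+ >= 2^k/m]: either [q_j] is far below the
    threshold, and the positive part absorbs the deviation (AM-GM), or bin [j] already
    contributes to the sum for the index [i - 2^k], which is at most [SCDL_m]. Each of the
    [log m] dyadic scales therefore costs only [sqrt (lambda m SCDL_m) + lambda m].

    Refining the grid increases [SCDL_{2^k}], so in the infimum defining [SCDL] one may assume
    [SCDL_m <= 2/m] and [m <= lambda^(-1/2)], and every scale costs [sqrt lambda]. The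
    comparison is symmetric in the two distributions. If [SCDL D = 0], only [lambda m] remains,
    and [m] close to [(lambda ln (1/lambda))^(-1/2)] is the best choice. *)

Set Implicit Arguments. Unset Strict Implicit. Unset Printing Implicit Defensive.

(** * Positive parts and hat functions *)

Section PositivePart.
Variable R : realType.
Implicit Types x y a : R.

Lemma posp_ge0 x : 0 <= posp x. Proof. by rewrite /posp le_max lexx orbT. Qed.

Lemma posp_ge x : x <= posp x. Proof. by rewrite /posp le_max lexx. Qed.

Lemma posp_le x y : x <= y -> 0 <= y -> posp x <= y.
Proof. by move=> xy y0; rewrite /posp ge_max xy. Qed.

Lemma ger0_posp x : 0 <= x -> posp x = x.
Proof. by move=> x0; rewrite /posp max_l. Qed.

Lemma ler0_posp x : x <= 0 -> posp x = 0.
Proof. by move=> x0; rewrite /posp max_r. Qed.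

Lemma le_posp x y : x <= y -> posp x <= posp y.
Proof. by move=> xy; apply: posp_le (posp_ge0 y); exact: le_trans xy (posp_ge y). Qed.

Lemma pospD x y : posp (x + y) <= posp x + posp y.
Proof. by apply: posp_le; rewrite ?lerD ?posp_ge ?addr_ge0 ?posp_ge0. Qed.

Lemma pospM a x : 0 <= a -> posp (a * x) = a * posp x.
Proof. by move=> a0; rewrite /posp maxr_pMr// mulr0. Qed.

(** Linear interpolation of the unit hat on the grid of mesh 1/2. Both sides are even, which leaves
    [0 <= x], where the hat centred at -1/2 vanishes. *)
Lemma hat_refine x : posp (1 - `|x|) =
  posp (1 - `|2 * x|) + 2^-1 * posp (1 - `|2 * x - 1|) + 2^-1 * posp (1 - `|2 * x + 1|).
Proof.
wlog x0 : x / 0 <= x => [wlog_x|].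
  have [/wlog_x//|x0] := leP 0 x.
  have := wlog_x (- x); rewrite oppr_ge0 ltW// => /(_ isT).
  have -> : 2 * - x - 1 = - (2 * x + 1) by ring.
  have -> : 2 * - x + 1 = - (2 * x - 1) by ring.
  by rewrite mulrN !normrN => ->; rewrite addrAC.
rewrite (ger0_norm x0) (@ger0_norm _ (2 * x)); last lra.
rewrite (@ger0_norm _ (2 * x + 1)); last lra.
rewrite (@ler0_posp (1 - (2 * x + 1))); last lra.
have [h|h] := leP x 1.
  rewrite (@ger0_posp (1 - x)); last lra.
  have [h'|h'] := leP (2 * x) 1.
    rewrite (@ger0_posp (1 - 2 * x)); last lra.
    by rewrite ler0_norm ?ger0_posp; lra.
  rewrite (@ler0_posp (1 - 2 * x)); last lra.
  by rewrite ger0_norm ?ger0_posp; lra.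
rewrite !ler0_posp ?ger0_norm; lra.
Qed.

(** The hats form a partition of unity on [[0, n]]; beyond [n] only the falling half of the last hat
    remains. *)
Lemma sum_hat n x : 0 <= x ->
  \sum_(j < n.+1) posp (1 - `|x - j%:R|) = Num.min 1 (posp (n.+1%:R - x)).
Proof.
move=> x0; elim: n => [|n IH].
  rewrite big_ord1 subr0 (ger0_norm x0) /posp maxEle minEle.
  by repeat case: ifP => ?; lra.
rewrite big_ord_recr /= IH -!(natr1 n.+1) -(natr1 n).
set k : R := n%:R; have k0 : 0 <= k by rewrite /k.
have [h|h] := leP x (k + 1); last have [h'|h'] := leP x (k + 2).
- rewrite (@ger0_posp (k + 1 - x)) ?subr_ge0//.
  rewrite (@min_l _ _ 1 (posp _)); last by rewrite ger0_posp; lra.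
  rewrite ler0_norm; last lra.
  have [h'|h'] := leP x k.
    by rewrite min_l ?(@ler0_posp (1 - _)); lra.
  by rewrite min_r ?(@ger0_posp (1 - _)); lra.
- rewrite (@ler0_posp (k + 1 - x)); last lra.
  rewrite (@ger0_posp (k + 1 + 1 - x)); last lra.
  by rewrite ger0_norm ?ger0_posp ?min_r; lra.
- rewrite (@ler0_posp (k + 1 - x)); last lra.
  rewrite (@ler0_posp (k + 1 + 1 - x)); last lra.
  by rewrite ger0_norm ?ler0_posp ?min_r; lra.
Qed.

Lemma hatw_ge0 m i (p : R) : 0 <= hatw m i p. Proof. exact: posp_ge0. Qed.

Lemma hatw_le1 m i (p : R) : hatw m i p <= 1.
Proof. by apply: posp_le => //; rewrite gerBl. Qed.

Lemma sum_hatw_le1 m n (p : R) : 0 <= p -> \sum_(j < n) hatw m j p <= 1.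
Proof.
case: n => [|n] p0; first by rewrite big_ord0.
by rewrite sum_hat ?mulr_ge0// ge_min lexx.
Qed.

Lemma hatw_refine0 m (p : R) : 0 <= p ->
  hatw m 0 p = hatw (2 * m) 0 p + 2^-1 * hatw (2 * m) 1 p.
Proof.
move=> p0; rewrite /hatw hat_refine natrM !subr0.
have mp0 : 0 <= m%:R * p by rewrite mulr_ge0.
rewrite [X in _ + X](_ : _ = 0) ?addr0 ?mulrA//.
by rewrite ler0_posp ?mulr0// ger0_norm; lra.
Qed.

Lemma hatw_refineS m i (p : R) : hatw m i.+1 p =
  hatw (2 * m) (2 * i).+2 p + 2^-1 * hatw (2 * m) (2 * i).+3 p
  + 2^-1 * hatw (2 * m) (2 * i).+1 p.
Proof.
rewrite /hatw hat_refine; set x := m%:R * p - _.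
have -> : (2 * m)%:R * p - (2 * i).+2%:R = 2 * x :> R.
  by rewrite /x -!natr1 !natrM; ring.
have -> : (2 * m)%:R * p - (2 * i).+3%:R = 2 * x - 1 :> R.
  by rewrite /x -!natr1 !natrM; ring.
have -> // : (2 * m)%:R * p - (2 * i).+1%:R = 2 * x + 1 :> R.
by rewrite /x -!natr1 !natrM; ring.
Qed.

Lemma hatw_refl m j (p : R) : (j <= m)%N -> hatw m j (1 - p) = hatw m (m - j) p.
Proof.
move=> jm; rewrite /hatw natrB// -normrN; congr (posp (1 - `| _ |)); ring.
Qed.

Lemma measurable_posp_comp d (U : measurableType d) (f : U -> R) :
  measurable_fun setT f -> measurable_fun setT (fun z => posp (f z)).
Proof. by move=> mf; apply: measurable_maxr => //; exact: measurable_cst. Qed.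

Lemma measurable_hatw d (U : measurableType d) (g : U -> R) m i :
  measurable_fun setT g -> measurable_fun setT (fun z => hatw m i (g z)).
Proof.
move=> mg; apply: measurable_posp_comp; apply: measurable_funB => //.
apply: measurableT_comp => //.
by apply: measurable_funB => //; apply: measurable_funM.
Qed.

End PositivePart.

(** * Expectation functionals of distributions on the support, true or empirical *)

Section MeanFunctional.
Variable R : realType.
Implicit Types (f g : R * R -> R) (E : (R * R -> R) -> R) (z : R * R).

Definition supp01 : set (R * R) := [set z | 0 <= z.1 <= 1 /\ (z.2 = 0 \/ z.2 = 1)].

(** Boundedness is asked on the support only, since [hatw m j z.1 * z.2] is unbounded in [z.2]
    elsewhere. *)
Definition admissible f :=
  measurable_fun setT f /\ exists M, forall z, supp01 z -> `|f z| <= M.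

(* What [expect_of D] and the empirical mean of a sample in the support have in common. *)
Record mean_functional E : Prop := MeanFunctional {
  mean_add : forall f g, admissible f -> admissible g ->
    E (fun z => f z + g z) = E f + E g ;
  mean_scale : forall c f, admissible f -> E (fun z => c * f z) = c * E f ;
  mean_le : forall f g, admissible f -> admissible g ->
    (forall z, supp01 z -> f z <= g z) -> E f <= E g ;
  mean_1 : E (fun=> 1) = 1 }.

(** This symmetry exchanges over- and underestimation, so that only one kind of sum has to be
    estimated. *)
Definition refl01 z : R * R := (1 - z.1, 1 - z.2).
Definition refl_mean E : (R * R -> R) -> R := fun f => E (f \o refl01).

Definition yw_ E m j : R := E (fun z => hatw m j z.1 * z.2).

Lemma supp01_refl z : supp01 z -> supp01 (refl01 z).
Proof.
by move=> [p01 y01]; split => /=; [lra | case: y01 => ->; [right|left]; lra].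
Qed.

Lemma admissibleD f g : admissible f -> admissible g -> admissible (fun z => f z + g z).
Proof.
move=> [mf [M Mf]] [mg [N Ng]]; split; first exact: measurable_funD.
exists (M + N) => z sz; apply: le_trans (ler_normD _ _) _.
by apply: lerD; [exact: Mf | exact: Ng].
Qed.

Lemma admissibleZ c f : admissible f -> admissible (fun z => c * f z).
Proof.
move=> [mf [M Mf]]; split; first exact: measurable_funM.
by exists (`|c| * M) => z sz; rewrite normrM ler_wpM2l// Mf.
Qed.

Lemma admissible_cst c : admissible (fun=> c).
Proof. by split; [exact: measurable_cst | exists `|c|]. Qed.

Lemma admissible_hatw m j : admissible (fun z => hatw m j z.1).
Proof.
split; first by apply: measurable_hatw; exact: measurable_fst.
by exists 1 => z _; rewrite ger0_norm ?hatw_ge0// hatw_le1.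
Qed.

Lemma admissible_hatwy m j : admissible (fun z => hatw m j z.1 * z.2).
Proof.
split.
  apply: measurable_funM; last exact: measurable_snd.
  by apply: measurable_hatw; exact: measurable_fst.
exists 1 => z [_ y01]; rewrite normrM ger0_norm ?hatw_ge0//.
by rewrite mulr_ile1 ?hatw_ge0 ?hatw_le1//; case: y01 => ->; rewrite ?normr0 ?normr1.
Qed.

Lemma admissible_refl f : admissible f -> admissible (f \o refl01).
Proof.
move=> [mf [M Mf]]; split.
  apply: measurableT_comp => //; apply/measurable_fun_pairP; split.
    by apply: measurable_funB => //; exact: measurable_fst.
  by apply: measurable_funB => //; exact: measurable_snd.
by exists M => z /supp01_refl; exact: Mf.
Qed.

Lemma mean_functional_refl E : mean_functional E -> mean_functional (refl_mean E).
Proof.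
move=> hE; split.
- by move=> f g af ag; apply: (mean_add hE); exact: admissible_refl.
- by move=> c f af; apply: (mean_scale hE); exact: admissible_refl.
- move=> f g af ag fg; apply: (mean_le hE); [exact: admissible_refl..|].
  by move=> z /supp01_refl; exact: fg.
- exact: (mean_1 hE).
Qed.

Section Theory.
Variables (E : (R * R -> R) -> R) (hE : mean_functional E).

Lemma eq_mean f g : admissible f -> admissible g ->
  (forall z, supp01 z -> f z = g z) -> E f = E g.
Proof.
by move=> af ag fg; apply/eqP; rewrite eq_le !(mean_le hE)// => z sz; rewrite fg.
Qed.

Lemma mean_cst c : E (fun=> c) = c.
Proof.
by rewrite -[in LHS](mulr1 c) (mean_scale hE c (admissible_cst 1)) (mean_1 hE) mulr1.
Qed.

Lemma mean_sum n (F : nat -> R * R -> R) : (forall i, admissible (F i)) ->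
  admissible (fun z => \sum_(i < n) F i z) /\
  E (fun z => \sum_(i < n) F i z) = \sum_(i < n) E (F i).
Proof.
move=> aF; elim: n => [|n [an En]].
  rewrite (_ : (fun z => _) = fun=> 0); last by apply/funext => z; rewrite big_ord0.
  by split; [exact: admissible_cst | rewrite mean_cst big_ord0].
rewrite (_ : (fun z => _) = fun z => \sum_(i < n) F i z + F n z).
  by split; [exact: admissibleD | rewrite (mean_add hE)// big_ord_recr/= En].
by apply/funext => z; rewrite big_ord_recr.
Qed.

Lemma mass_ge0 m j : 0 <= pi_ E m j.
Proof.
rewrite -[X in X <= _](mean_cst 0); apply: (mean_le hE).
- exact: admissible_cst.
- exact: admissible_hatw.
- by move=> z _; exact: hatw_ge0.
Qed.

Lemma yw_ge0 m j : 0 <= yw_ E m j.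
Proof.
rewrite -[X in X <= _](mean_cst 0); apply: (mean_le hE).
- exact: admissible_cst.
- exact: admissible_hatwy.
- by move=> z [_ [->|->]]; rewrite ?mulr0// mulr1 hatw_ge0.
Qed.

Lemma yw_le_mass m j : yw_ E m j <= pi_ E m j.
Proof.
apply: (mean_le hE); [exact: admissible_hatwy | exact: admissible_hatw|].
by move=> z [_ [->|->]]; rewrite ?mulr0 ?mulr1// hatw_ge0.
Qed.

Lemma sum_mass_le1 m n : \sum_(j < n) pi_ E m j <= 1.
Proof.
have [aS ES] := mean_sum n (admissible_hatw m).
rewrite -ES -[X in _ <= X](mean_cst 1); apply: (mean_le hE) => //.
  exact: admissible_cst.
by move=> z [/andP[z0 _] _]; exact: sum_hatw_le1.
Qed.

Lemma mass_le1 m j : pi_ E m j <= 1.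
Proof.
apply: le_trans (sum_mass_le1 m j.+1); rewrite big_ord_recr /= lerDr.
by apply: sumr_ge0 => i _; exact: mass_ge0.
Qed.

Let half_sum f g h : admissible f -> admissible g -> admissible h ->
  E (fun z => f z + 2^-1 * g z + 2^-1 * h z) = E f + 2^-1 * E g + 2^-1 * E h.
Proof.
move=> af ag ah.
rewrite (mean_add hE (admissibleD af (admissibleZ _ ag)) (admissibleZ _ ah)).
by rewrite (mean_add hE af (admissibleZ _ ag)) !(mean_scale hE).
Qed.

Lemma mass_refineS m i : pi_ E m i.+1 =
  pi_ E (2 * m) (2 * i).+2 + 2^-1 * pi_ E (2 * m) (2 * i).+3
  + 2^-1 * pi_ E (2 * m) (2 * i).+1.
Proof.
rewrite /pi_ -half_sum; try exact: admissible_hatw.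
by congr E; apply/funext => z; rewrite hatw_refineS.
Qed.

Lemma yw_refineS m i : yw_ E m i.+1 =
  yw_ E (2 * m) (2 * i).+2 + 2^-1 * yw_ E (2 * m) (2 * i).+3
  + 2^-1 * yw_ E (2 * m) (2 * i).+1.
Proof.
rewrite /yw_ -half_sum; try exact: admissible_hatwy.
by congr E; apply/funext => z; rewrite hatw_refineS; ring.
Qed.

Lemma mass_refine0 m : pi_ E m 0 = pi_ E (2 * m) 0 + 2^-1 * pi_ E (2 * m) 1.
Proof.
have a j := admissible_hatw (2 * m) j.
rewrite /pi_ -(mean_scale hE)// -(mean_add hE)//; last exact: admissibleZ.
apply: eq_mean; [exact: admissible_hatw | exact: admissibleD (a _) (admissibleZ _ (a _))|].
by move=> z [/andP[z0 _] _]; exact: hatw_refine0.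
Qed.

Lemma yw_refine0 m : yw_ E m 0 = yw_ E (2 * m) 0 + 2^-1 * yw_ E (2 * m) 1.
Proof.
have a j := admissible_hatwy (2 * m) j.
rewrite /yw_ -(mean_scale hE)// -(mean_add hE)//; last exact: admissibleZ.
apply: eq_mean; [exact: admissible_hatwy | exact: admissibleD (a _) (admissibleZ _ (a _))|].
by move=> z [/andP[z0 _] _]; rewrite hatw_refine0//; ring.
Qed.

Lemma mass_refl m j : (j <= m)%N -> pi_ (refl_mean E) m j = pi_ E m (m - j).
Proof.
by move=> jm; congr E; apply/funext => z /=; rewrite hatw_refl.
Qed.

Lemma yw_refl m j : (j <= m)%N ->
  yw_ (refl_mean E) m j = pi_ E m (m - j) - yw_ E m (m - j).
Proof.
move=> jm; rewrite /yw_ /refl_mean /=.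
rewrite -[in RHS]mulN1r -(mean_scale hE) -?(mean_add hE).
- by congr E; apply/funext => z /=; rewrite hatw_refl//; ring.
- exact: admissible_hatw.
- exact: admissibleZ (admissible_hatwy _ _).
- exact: admissible_hatwy.
Qed.

End Theory.
End MeanFunctional.

(** * SCDL as a sum of one-sided overshoots *)

Section OneSided.
Variable R : realType.
Implicit Types (E : (R * R -> R) -> R).

(* With [n = i + 1] this is the first sum in [SCDL_m]; the second sum is the same
   expression for the reflected functional, with [n = m - i]. *)
Definition overshoot E (m n : nat) : R :=
  \sum_(j < n) posp (yw_ E m j - n%:R / m%:R * pi_ E m j).

Lemma overshoot_ge0 E m n : 0 <= overshoot E m n.
Proof. by apply: sumr_ge0 => j _; exact: posp_ge0. Qed.

Section Theory.
Variables (E : (R * R -> R) -> R) (hE : mean_functional E).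

(** Multiplying by the mass clears the quotient in [q_]. In a bin of mass zero the convention
    [x / 0 = 0] is consistent, because [0 <= yw_ <= pi_] forces [yw_] to vanish as well. *)
Lemma pi_posp_q m j (c : R) :
  pi_ E m j * posp (q_ E m j - c) = posp (yw_ E m j - c * pi_ E m j) /\
  pi_ E m j * posp (c - q_ E m j) = posp (c * pi_ E m j - yw_ E m j).
Proof.
have p0 := mass_ge0 hE m j; rewrite -!pospM// !mulrBr ![c * _]mulrC.
suff -> : pi_ E m j * q_ E m j = yw_ E m j by [].
rewrite /q_ -/(yw_ E m j).
have [e|/eqP e] := eqVneq (pi_ E m j) 0; last by rewrite mulrCA mulfV ?mulr1//; apply/eqP.
apply/esym/eqP; rewrite e mul0r eq_le yw_ge0// andbT.
by apply: le_trans (yw_le_mass hE m j) _; rewrite e.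
Qed.

(** Substituting [m - j] for [j] in the second sum turns [i < j] into an initial segment of length
    [m - i], and [i/m * pi - yw = (pi - yw) - (m - i)/m * pi] is the reflected term. *)
Lemma SCDL_mE m : (0 < m)%N -> SCDL_m E m =
  \big[Num.max/0]_(i < m.+1) (overshoot E m i.+1 + overshoot (refl_mean E) m (m - i)).
Proof.
move=> m0; apply: eq_bigr => i _; congr (_ + _).
  rewrite /overshoot (big_ord_widen_cond m.+1 predT (fun j => posp (yw_ E m j - _ * pi_ E m j)))//.
  by apply: eq_bigr => j _; exact: (pi_posp_q _ _ _).1.
have im : (i <= m)%N by rewrite -ltnS.
rewrite /overshoot (big_ord_widen_cond m.+1 predT
  (fun j => posp (yw_ (refl_mean E) m j - _ * pi_ (refl_mean E) m j))) ?leqW ?leq_subr//.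
rewrite (reindex_inj rev_ord_inj) /=; apply: eq_big => j.
  by rewrite subSS; have := ltn_ord j; lia.
rewrite subSS => ij; have jm : (j <= m)%N by rewrite -ltnS.
rewrite (pi_posp_q _ _ _).2 mass_refl// yw_refl// natrB//; congr posp.
by field; rewrite pnatr_eq0 -lt0n.
Qed.

Lemma overshoot_big m n : (0 < m)%N -> (m <= n)%N -> overshoot E m n = 0.
Proof.
move=> m0 mn; apply: big1 => j _; apply: ler0_posp; rewrite subr_le0.
apply: le_trans (yw_le_mass hE m j) _; rewrite ler_peMl ?mass_ge0//.
by rewrite ler_pdivlMr ?ltr0n// mul1r ler_nat.
Qed.

Lemma le_SCDL_m m i : (0 < m)%N -> (i <= m)%N ->
  overshoot E m i.+1 + overshoot (refl_mean E) m (m - i) <= SCDL_m E m.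
Proof.
move=> m0 im; rewrite SCDL_mE//.
exact: (le_bigmax _ (fun i : 'I_m.+1 =>
  overshoot E m i.+1 + overshoot (refl_mean E) m (m - i)) (Ordinal (im : (i < m.+1)%N))).
Qed.

Lemma SCDL_m_ge0 m : 0 <= SCDL_m E m.
Proof. exact: bigmax_ge_id. Qed.

Lemma SCDL_m_le m s : (0 < m)%N -> 0 <= s -> (forall i, (i < m)%N ->
    overshoot E m i.+1 + overshoot (refl_mean E) m (m - i) <= s) -> SCDL_m E m <= s.
Proof.
move=> m0 s0 Fs; rewrite SCDL_mE//; apply: bigmax_le => // i _.
(* The index [i = m] contributes nothing: its threshold [(m + 1)/m] exceeds 1, and its reflected sum
   is empty. *)
have := ltn_ord i; rewrite ltnS leq_eqVlt => /predU1P[->|/Fs//].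
by rewrite subnn /overshoot big_ord0 addr0 -/(overshoot E m m.+1) overshoot_big.
Qed.

Lemma overshoot_le_SCDL_m m n : (0 < m)%N -> (n <= m)%N ->
  overshoot E m n <= SCDL_m E m /\ overshoot (refl_mean E) m n <= SCDL_m E m.
Proof.
move=> m0 nm; split.
  case: n nm => [|n] nm; first by rewrite /overshoot big_ord0 SCDL_m_ge0.
  by apply: le_trans (le_SCDL_m m0 (ltnW nm)); rewrite lerDl overshoot_ge0.
have := le_SCDL_m m0 (leq_subr n m); rewrite subKn//.
by apply: le_trans; rewrite lerDr overshoot_ge0.
Qed.

Lemma SCDL_m_le1 m : (0 < m)%N -> SCDL_m E m <= 1.
Proof.
move=> m0; rewrite -[leLHS]/(\big[Num.max/0]_(i < m.+1) _).
apply: bigmax_le => // i _; rewrite -[leRHS](addr0 1).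
apply: le_trans (_ : _ <= \sum_(j < m.+1) pi_ E m j) _; last first.
  by rewrite addr0 sum_mass_le1.
rewrite [leRHS](bigID (fun j : 'I_m.+1 => (j <= i)%N)) /=.
apply: lerD.
  apply: ler_sum => j _; rewrite (pi_posp_q _ _ _).1; apply: posp_le (mass_ge0 hE m j).
  rewrite lerBlDr; apply: le_trans (yw_le_mass hE m j) _.
  by rewrite lerDl mulr_ge0 ?mass_ge0// divr_ge0.
rewrite [leRHS](eq_bigl (fun j : 'I_m.+1 => (i < j)%N)); last by move=> j; rewrite ltnNge.
apply: ler_sum => j _; rewrite (pi_posp_q _ _ _).2; apply: posp_le (mass_ge0 hE m j).
rewrite lerBlDr; apply: le_trans (_ : _ <= pi_ E m j) _; last by rewrite lerDl yw_ge0.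
rewrite ler_piMl ?mass_ge0// ler_pdivrMr ?ltr0n// mul1r ler_nat.
by rewrite -ltnS.
Qed.

(* The coarse hat is the fine hat plus half of its two neighbours, and [posp] is subadditive. *)
Lemma sum_refine (c : R) m n : 0 <= c ->
  \sum_(j < n.+1) posp (yw_ E m j - c * pi_ E m j) <=
  \sum_(j < (2 * n).+1) posp (yw_ E (2 * m) j - c * pi_ E (2 * m) j)
  + 2^-1 * posp (yw_ E (2 * m) (2 * n).+1 - c * pi_ E (2 * m) (2 * n).+1).
Proof.
move=> c0; pose f j := yw_ E (2 * m) j - c * pi_ E (2 * m) j.
rewrite -[leRHS]/(\sum_(j < (2 * n).+1) posp (f j) + 2^-1 * posp (f (2 * n).+1)).
elim: n => [|n IH].
  rewrite !muln0 !big_ord1 mass_refine0// yw_refine0//.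
  have -> : yw_ E (2 * m) 0 + 2^-1 * yw_ E (2 * m) 1
    - c * (pi_ E (2 * m) 0 + 2^-1 * pi_ E (2 * m) 1) = f 0 + 2^-1 * f 1.
    by rewrite /f; ring.
  by rewrite -pospM//; exact: pospD.
rewrite big_ord_recr/=; apply: le_trans (lerD IH (lexx _)) _.
rewrite mass_refineS// yw_refineS//.
set x := _ - c * _; have {x}-> : x = f (2 * n).+2 + 2^-1 * f (2 * n).+3 + 2^-1 * f (2 * n).+1.
  by rewrite /x /f; ring.
have -> : (2 * n.+1)%N = (2 * n).+2 by lia.
rewrite !big_ord_recr/=.
have := pospD (f (2 * n).+2 + 2^-1 * f (2 * n).+3) (2^-1 * f (2 * n).+1).
have := pospD (f (2 * n).+2) (2^-1 * f (2 * n).+3).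
rewrite !pospM//; lra.
Qed.

(** In [sum_refine] the last fine bin has weight 1/2, so the bound is the average of the sums over
    [2n - 1] and [2n] bins, both with threshold [n/m = 2n/(2m)]. In the shorter sum the threshold is
    lowered to [(2n - 1)/(2m)], which only increases it. *)
Lemma overshoot_refine m n : (0 < m)%N ->
  overshoot E m n <= 2^-1 * (overshoot E (2 * m) (2 * n).-1 + overshoot E (2 * m) (2 * n)).
Proof.
move=> m0; case: n => [|n].
  by rewrite muln0 /overshoot !big_ord0 addr0 mulr0.
have -> : (2 * n.+1)%N = (2 * n).+2 by lia.
rewrite /=; apply: le_trans (sum_refine m n _) _ => //.
set c : R := n.+1%:R / m%:R.
have eqc : c = (2 * n).+2%:R / (2 * m)%:R.
  rewrite /c (_ : (2 * n).+2 = (2 * n.+1)%N); last lia.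
  by rewrite !natrM; field; rewrite pnatr_eq0 -lt0n.
have lc : (2 * n).+1%:R / (2 * m)%:R <= c.
  by rewrite eqc ler_wpM2r ?ler_nat.
have : \sum_(j < (2 * n).+1) posp (yw_ E (2 * m) j - c * pi_ E (2 * m) j)
    <= overshoot E (2 * m) (2 * n).+1.
  apply: ler_sum => j _; apply: le_posp; rewrite lerD2l lerN2.
  by rewrite ler_wpM2r// mass_ge0.
rewrite [overshoot E (2 * m) (2 * n).+2]/overshoot -eqc [\sum_(j < (2 * n).+2) _]big_ord_recr /=; lra.
Qed.

End Theory.

(** By [overshoot_refine] for both halves, the coarse value at [i] is at most the average of the
    fine values at [2i] and [2i + 1]. *)
Lemma SCDL_m_double E m : mean_functional E -> (0 < m)%N -> SCDL_m E m <= SCDL_m E (2 * m).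
Proof.
move=> hE m0; have m20 : (0 < 2 * m)%N by lia.
apply: SCDL_m_le => //; first exact: SCDL_m_ge0.
move=> i im.
have := overshoot_refine hE i.+1 m0.
have := overshoot_refine (mean_functional_refl hE) (m - i) m0.
have h1 : (2 * i <= 2 * m)%N by lia.
have h2 : ((2 * i).+1 <= 2 * m)%N by lia.
have := le_SCDL_m hE m20 h1; have := le_SCDL_m hE m20 h2.
have -> : (2 * m - 2 * i)%N = (2 * (m - i))%N by lia.
have -> : (2 * m - (2 * i).+1)%N = (2 * (m - i)).-1 by lia.
have -> : (2 * i.+1)%N = (2 * i).+2 by lia.
by rewrite [(2 * i).+2.-1]/=; lra.
Qed.

Lemma SCDL_m_pow_mono E k l : mean_functional E -> (k <= l)%N ->
  SCDL_m E (2 ^ k) <= SCDL_m E (2 ^ l).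
Proof.
move=> hE; elim: l => [|l IH]; first by rewrite leqn0 => /eqP ->.
rewrite leq_eqVlt => /predU1P[->//|/IH/le_trans]; apply.
by rewrite expnS SCDL_m_double ?expn_gt0.
Qed.

End OneSided.

(** * The dyadic deviation estimate *)

Section Deviation.
Variable R : realType.

Lemma dyadic_sum (e : nat -> R) (B : R) (K : nat) :
  (forall l, (l < K)%N -> \sum_(2 ^ l <= h < 2 ^ l.+1) e h <= B) ->
  \sum_(1 <= h < 2 ^ K) e h <= K%:R * B.
Proof.
elim: K => [|K IH] eB; first by rewrite big_geq// mul0r.
rewrite (@big_cat_nat _ _ _ (2 ^ K)%N) ?expn_gt0 ?leq_exp2l//=.
rewrite -natr1 mulrDl mul1r lerD ?eB//.
by apply: IH => l lK; apply: eB; exact: ltnW.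
Qed.

Lemma amgm_sqrt (p a k l : R) : 0 < p -> 0 <= a -> 0 <= l ->
  2 * k * Num.sqrt (l * a) <= p * a + k ^+ 2 * l / p.
Proof.
move=> p0 a0 l0; rewrite sqrtrM//.
have := sqr_sqrtr a0; have := sqr_sqrtr l0.
move: (Num.sqrt a) (Num.sqrt l) => x y <- <-.
rewrite -subr_ge0.
have -> : p * x ^+ 2 + k ^+ 2 * y ^+ 2 / p - 2 * k * (y * x) = p^-1 * (p * x - k * y) ^+ 2.
  by field; lra.
by rewrite mulr_ge0 ?sqr_ge0 ?invr_ge0 ?ltW.
Qed.

(** AM-GM bounds the deviation [2 k sqrt (l a)] by [theta g a + k^2 l / (theta g)], and [theta g a =
    theta (u - (c - g) a) - theta (u - c a)]. The first part is an overshoot at the threshold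
    lowered by [g]; the second is absorbed by [u - c a], whatever its sign, because [theta <= 1]. *)
Lemma posp_excess (a u b v c g theta k l : R) :
  0 <= a -> 0 <= l -> 0 <= k -> 0 <= c <= 1 -> 0 < g -> 0 < theta <= 1 ->
  `|b - a| <= k * (Num.sqrt (l * a) + l) -> `|v - u| <= k * (Num.sqrt (l * a) + l) ->
  posp (v - c * b) <= posp (u - c * a) + 2 * k * l
    + (theta * posp (u - (c - g) * a) + k ^+ 2 * l / (theta * g)).
Proof.
move=> a0 l0 k0 /andP[c0 c1] g0 /andP[t0 t1] hb hv.
have p0 : 0 < theta * g by rewrite mulr_gt0.
have := amgm_sqrt k p0 a0 l0.
set w := Num.sqrt _ in hb hv *; set q := _ / (theta * g) => amgm.
have q0 : 0 <= q by rewrite /q divr_ge0 ?mulr_ge0 ?sqr_ge0// ltW.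
have w0 : 0 <= w by rewrite sqrtr_ge0.
have kl0 : 0 <= k * l by rewrite mulr_ge0.
have tf0 : 0 <= theta * posp (u - (c - g) * a) by rewrite mulr_ge0 ?posp_ge0 ?ltW.
have f1 : u - (c - g) * a <= posp (u - (c - g) * a) by exact: posp_ge.
have {}f1 : theta * (u - (c - g) * a) <= theta * posp (u - (c - g) * a).
  by rewrite ler_wpM2l// ltW.
have vb : v - c * b <= u - c * a + 2 * k * w + 2 * k * l.
  have : c * (a - b) <= c * (k * (w + l)).
    by apply: ler_wpM2l => //; apply: le_trans hb; rewrite -normrN opprB ler_norm.
  have : c * (k * (w + l)) <= k * (w + l).
    by rewrite ler_piMl// mulr_ge0// addr_ge0.
  have : v - u <= k * (w + l) by apply: le_trans hv; exact: ler_norm.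
  by rewrite !mulrDr !mulrDl; lra.
have pt0 := posp_ge0 (u - c * a).
apply: posp_le; last by rewrite !addr_ge0// -mulrA mulr_ge0.
apply: le_trans vb _.
have [t0'|t0'] := leP 0 (u - c * a).
  have : 0 <= theta * (u - c * a) by rewrite mulr_ge0// ltW.
  by rewrite ger0_posp//; lra.
have : (1 - theta) * (u - c * a) <= 0.
  by rewrite mulr_ge0_le0 ?subr_ge0// ltW.
rewrite (ler0_posp (ltW t0')); lra.
Qed.

Lemma sum_nat_le (F : nat -> R) (a b n : nat) : (forall h, 0 <= F h) -> (a <= b)%N ->
  \sum_(a <= h < b | (h < n)%N) F h <= \sum_(a <= h < n) F h.
Proof.
move=> F0 ab; have [bn|nb] := leqP b n.
  rewrite (@big_cat_nat _ _ _ b _ _ predT)//=.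
  rewrite -[leLHS]addr0 lerD ?sumr_ge0//.
  by rewrite [leLHS]big_mkcond; apply: ler_sum => h _; case: ifP.
by rewrite [leRHS](big_nat_widen _ _ b)//= ltnW.
Qed.

(** Bins are grouped by their distance [h] to the last bin [N]. For [2^i <= h < 2^(i+1)] the gap
    [g = 2^i/m] is used in [posp_excess]; each of the [K] groups costs [theta * s] plus the AM-GM
    remainder. *)
Lemma overshoot_deviation (a u b v : nat -> R) (k l theta s : R) (m n K : nat) :
  (0 < n)%N -> (n <= m)%N -> (n <= 2 ^ K)%N -> 0 <= k -> 0 <= l -> 0 < theta <= 1 ->
  (forall j, 0 <= a j <= 1) ->
  (forall j, (j < n)%N -> `|b j - a j| <= k * (Num.sqrt (l * a j) + l)) ->
  (forall j, (j < n)%N -> `|v j - u j| <= k * (Num.sqrt (l * a j) + l)) ->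
  (forall n', (n' <= n)%N -> \sum_(j < n') posp (u j - n'%:R / m%:R * a j) <= s) ->
  \sum_(j < n) posp (v j - n%:R / m%:R * b j) <=
  \sum_(j < n) posp (u j - n%:R / m%:R * a j)
  + (2 * k * l * n%:R + 2 * k * Num.sqrt l + K%:R * (theta * s + k ^+ 2 * l * m%:R / theta)).
Proof.
case: n => // N _; set n := N.+1 => nm nK k0 l0 t01 a01 hb hv hs.
have m0 : 0 < m%:R :> R by rewrite ltr0n (leq_trans _ nm).
set c : R := n%:R / m%:R.
have c01 : 0 <= c <= 1.
  by rewrite divr_ge0//= ler_pdivrMr// mul1r ler_nat.
have t0 : 0 < theta by case/andP: t01.
have s0 : 0 <= s by have := hs 0 isT; rewrite big_ord0.
pose x j := posp (v j - c * b j) - posp (u j - c * a j) - 2 * k * l.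
suff : \sum_(j < n) x j <= 2 * k * Num.sqrt l + K%:R * (theta * s + k ^+ 2 * l * m%:R / theta).
  rewrite /x !sumrB sumr_const card_ord -mulr_natr; lra.
rewrite -(big_mkord xpredT x) big_nat_rev /= big_ltn//.
(* At distance 0 there is no gap to exploit; the plain deviation with [a N <= 1] is affordable for a
   single bin. *)
have xN : x N <= 2 * k * Num.sqrt l.
  have /andP[aN0 aN1] := a01 N.
  have := pospD (u N - c * a N) (2 * (k * (Num.sqrt (l * a N) + l))).
  rewrite [posp (2 * _)]ger0_posp; last first.
    by rewrite !mulr_ge0// addr_ge0// sqrtr_ge0.
  have : posp (v N - c * b N) <= posp (u N - c * a N + 2 * (k * (Num.sqrt (l * a N) + l))).
    apply: le_posp; have := hb N (ltnSn N); have := hv N (ltnSn N).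
    set r := k * _; rewrite !ler_norml => /andP[_ h1] /andP[h2 _].
    have r0 : 0 <= r by rewrite mulr_ge0// addr_ge0// sqrtr_ge0.
    have [c0 c1] := andP c01.
    have : c * (- r) <= c * (b N - a N) by rewrite ler_wpM2l.
    have : c * r <= r by rewrite ler_piMl.
    lra.
  have : k * Num.sqrt (l * a N) <= k * Num.sqrt l.
    by rewrite ler_wpM2l// ler_wsqrtr// ler_piMr.
  by rewrite /x; lra.
apply: lerD; first by rewrite add0n subn1.
(* Padding by zero makes the range of distances end at a power of two. *)
pose e h := if (h < n)%N then x (N - h)%N else 0.
have -> : \sum_(1 <= h < n) x (0 + n - h.+1)%N = \sum_(1 <= h < 2 ^ K) e h.
  rewrite (big_nat_widen _ _ _ _ _ nK) big_mkcondr /=.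
  by apply: eq_bigr => h _; rewrite /e add0n subSS.
apply: dyadic_sum => i iK.
pose f j := posp (u j - (n - 2 ^ i)%N%:R / m%:R * a j).
have f0 j : 0 <= f j by exact: posp_ge0.
pose q := k ^+ 2 * l * m%:R / theta.
have q0 : 0 <= q by rewrite /q divr_ge0 ?mulr_ge0 ?sqr_ge0// ltW.
have le_e h : (2 ^ i <= h)%N ->
    e h <= (if (h < n)%N then theta * f (N - h)%N else 0) + q / (2 ^ i)%:R.
  move=> ih; rewrite /e; case: ifP => hn; last by rewrite add0r divr_ge0.
  have jn : (N - h < n)%N by rewrite ltnS leq_subr.
  have g0 : 0 < (2 ^ i)%:R / m%:R :> R by rewrite divr_gt0// ltr0n expn_gt0.
  have /andP[a0 _] := a01 (N - h)%N.
  have := posp_excess a0 l0 k0 c01 g0 t01 (hb _ jn) (hv _ jn).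
  rewrite /c -mulrBl -natrB; last exact: leq_trans ih (ltnW hn).
  rewrite -/c -/(f _).
  suff -> : k ^+ 2 * l / (theta * ((2 ^ i)%:R / m%:R)) = q / (2 ^ i)%:R.
    by rewrite /x; lra.
  rewrite /q; field; by rewrite !gt_eqF// ltr0n expn_gt0.
apply: le_trans (_ : _ <= \sum_(2 ^ i <= h < 2 ^ i.+1)
    ((if (h < n)%N then theta * f (N - h)%N else 0) + q / (2 ^ i)%:R)) _.
  by rewrite !big_nat; apply: ler_sum => h /andP[ih _]; exact: le_e.
(* The group has [2^i] members with remainder [q / 2^i] each, hence total [q] at every scale. *)
rewrite big_split /= sumr_const_nat -/q; apply: lerD; last first.
  rewrite expnS mul2n -addnn addnK -[leLHS]mulr_natr divfK// gt_eqF// ltr0n expn_gt0.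
rewrite -big_mkcond /= -mulr_sumr ler_wpM2l ?(ltW t0)//.
apply: le_trans (sum_nat_le _ _ _) _; [by []|by rewrite leq_exp2l|].
(* Distances [h >= 2^i] correspond to [j = N - h < n - 2^i]: exactly the bins summed in [hs] for
   [n' = n - 2^i], whose threshold is the one in [f]. *)
rewrite big_rev_mkord /=.
apply: le_trans (hs (n - 2 ^ i)%N (leq_subr _ _)).
apply: ler_sum => j _; rewrite -/(f j) (_ : (N - (n - j.+1))%N = j) //.
by rewrite /n subSS subKn// -ltnS (leq_trans (ltn_ord j))// leq_subr.
Qed.

End Deviation.

(** * Comparing the SCDL of two close functionals *)

Section Comparison.
Variable R : realType.
Implicit Types (E : (R * R -> R) -> R) (k l : R).

Definition scdl_set E :=
  [set Num.max (SCDL_m E (2 ^ k.+1)%N) ((2 ^ k.+1)%N%:R)^-1 | k in [set: nat]].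

Lemma SCDL_le E (k : nat) : SCDL E <= Num.max (SCDL_m E (2 ^ k.+1)) (2 ^ k.+1)%:R^-1.
Proof.
apply: (@ge_inf _ (scdl_set E)); last by exists k.
exists 0 => _ [i _ <-]; rewrite le_max; apply/orP; left.
exact: SCDL_m_ge0.
Qed.

Lemma le_SCDL E x :
  (forall k : nat, x <= Num.max (SCDL_m E (2 ^ k.+1)) (2 ^ k.+1)%:R^-1) -> x <= SCDL E.
Proof.
move=> xE; apply: (@lb_le_inf _ (scdl_set E)); last by move=> _ [k _ <-].
by exists (Num.max (SCDL_m E (2 ^ 1)%N) ((2 ^ 1)%N%:R)^-1), 0%N.
Qed.

Lemma SCDL_ge0 E : 0 <= SCDL E.
Proof. by apply: le_SCDL => k; rewrite le_max; apply/orP; left; exact: SCDL_m_ge0. Qed.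

Lemma SCDL_le1 E : mean_functional E -> SCDL E <= 1.
Proof.
move=> hE; apply: le_trans (SCDL_le E 0) _.
by rewrite ge_max SCDL_m_le1//= invf_le1 ?ltr0n// ler1n.
Qed.

Lemma pow2_bracket (x : R) : 2 <= x ->
  exists K, [/\ (0 < K)%N, (2 ^ K)%:R <= x & x < 2 * (2 ^ K)%:R].
Proof.
move=> x2; have x0 : 0 <= x by lra.
have /andP[t1 t2] := truncn_itv x0.
have n2 : (2 <= Num.truncn x)%N.
  by rewrite -ltnS -(ltr_nat R); apply: le_lt_trans t2.
have n0 : (0 < Num.truncn x)%N by exact: leq_trans n2.
have /andP[l1 l2] := trunc_log_bounds (ltnSn 1) n0.
exists (trunc_log 2 (Num.truncn x)); split.
- by rewrite lt0n; apply: contraTneq l2 => ->; rewrite -leqNgt.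
- by apply: le_trans t1; rewrite ler_nat.
- by apply: lt_le_trans t2 _; rewrite -natrM -expnS ler_nat.
Qed.

Lemma ln2_ge : 2^-1 <= ln 2 :> R.
Proof.
rewrite -[leLHS]expRK ler_ln ?posrE ?expR_gt0//.
have := expR_ge1Dx (- 2^-1 : R); rewrite expRN => h.
have e0 := expR_gt0 (2^-1 : R).
have := ler_wpM2l (ltW e0) h; rewrite mulfV ?gt_eqF//; lra.
Qed.

Lemma pow2_le_ln K (x : R) : 0 < x -> (2 ^ K)%:R <= x -> K%:R <= 2 * ln x.
Proof.
move=> x0 Kx; have : ln (2 ^ K)%:R <= ln x.
  by rewrite ler_ln ?posrE// ltr0n expn_gt0.
rewrite natrX lnXn// -[ln 2 *+ K]mulr_natr => h.
have : 2^-1 * K%:R <= ln 2 * K%:R :> R by rewrite ler_wpM2r// ln2_ge.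
lra.
Qed.

Lemma ln_inv_ge l : 0 < l -> l < 2^-1 -> 2^-1 <= ln l^-1.
Proof.
move=> l0 l2; apply: le_trans ln2_ge _; rewrite ler_ln ?posrE ?invr_gt0//.
by rewrite -[leLHS]invrK lef_pV2 ?posrE ?invr_gt0// ltW.
Qed.

(** Bernstein-type closeness, relative to the masses of [E1]. The cap on [m] leaves finitely many
    statistics when [l > 0], which makes a union bound possible. *)
Definition stat_close k l E1 E2 := forall m j : nat, (0 < m)%N -> (j <= m)%N ->
  l * m%:R ^+ 2 <= 4 ->
  `|pi_ E2 m j - pi_ E1 m j| <= k * (Num.sqrt (l * pi_ E1 m j) + l) /\
  `|yw_ E2 m j - yw_ E1 m j| <= k * (Num.sqrt (l * pi_ E1 m j) + l).

(** Absorbing half of [a] by AM-GM gives [a <= 2 b + 3 k^2 l], hence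
    [sqrt (l a) <= 2 sqrt (l b) + 2 k l]: either mass can serve as the variance proxy. *)
Lemma stat_close_sym k l E1 E2 : mean_functional E1 -> mean_functional E2 ->
  1 <= k -> 0 <= l -> stat_close k l E1 E2 -> stat_close (3 * k ^+ 2) l E2 E1.
Proof.
move=> h1 h2 k1 l0 c m j m0 jm ml; have [c1 c2] := c m j m0 jm ml.
rewrite distrC [`|yw_ E1 _ _ - _|]distrC.
set a := pi_ E1 m j in c1 c2 *; set b := pi_ E2 m j in c1 *.
have a0 : 0 <= a by exact: mass_ge0.
have b0 : 0 <= b by exact: mass_ge0.
suff h : k * (Num.sqrt (l * a) + l) <= 3 * k ^+ 2 * (Num.sqrt (l * b) + l).
  by split; [exact: le_trans c1 h | exact: le_trans c2 h].
have k0 : 0 <= k by lra.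
have kk : k <= k ^+ 2 by rewrite expr2 ler_peMl.
have la : a <= 2 * b + 3 * k ^+ 2 * l.
  have p2 : 0 < 2^-1 :> R by [].
  have := amgm_sqrt (k / 2) p2 a0 l0.
  rewrite [2 * (k / 2)]mulrC divfK// mulrC.
  have : a - b <= k * (Num.sqrt (l * a) + l).
    by apply: le_trans c1; rewrite distrC ler_norm.
  have : k * l <= k ^+ 2 * l by rewrite ler_wpM2r.
  have -> : (k / 2) ^+ 2 * l / 2^-1 = k ^+ 2 * l / 2 by field.
  rewrite mulrDr; lra.
have sb0 := sqrtr_ge0 (l * b).
have : Num.sqrt (l * a) <= 2 * Num.sqrt (l * b) + 2 * k * l.
  rewrite -[leRHS]ger0_norm; last by rewrite addr_ge0 ?mulr_ge0.
  rewrite -sqrtr_sqr ler_wsqrtr// sqrrD !exprMn sqr_sqrtr ?mulr_ge0//.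
  have := ler_wpM2l l0 la.
  have : 0 <= 2 * Num.sqrt (l * b) * (2 * k * l) *+ 2 by rewrite mulrn_wge0// !mulr_ge0.
  have : 0 <= l * b by rewrite mulr_ge0.
  have : 0 <= k ^+ 2 * l ^+ 2 by rewrite mulr_ge0 ?sqr_ge0.
  have -> : 2 ^+ 2 = 4 :> R by rewrite -natrX.
  have -> : l * (2 * b + 3 * k ^+ 2 * l) = 2 * (l * b) + 3 * (k ^+ 2 * l ^+ 2) by ring.
  lra.
move=> /(ler_wpM2l k0).
have : k * Num.sqrt (l * b) <= k ^+ 2 * Num.sqrt (l * b) by rewrite ler_wpM2r.
have : k * l <= k ^+ 2 * l by rewrite ler_wpM2r.
have : 0 <= k ^+ 2 * Num.sqrt (l * b) by rewrite mulr_ge0 ?sqr_ge0.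
have -> : k * (2 * Num.sqrt (l * b) + 2 * k * l) =
  2 * (k * Num.sqrt (l * b)) + 2 * (k ^+ 2 * l) by ring.
rewrite !mulrDr; lra.
Qed.

Section Close.
Variables (k l : R) (E1 E2 : (R * R -> R) -> R).
Hypotheses (hE1 : mean_functional E1) (hE2 : mean_functional E2).
Hypotheses (k1 : 1 <= k) (l0 : 0 < l) (l2 : l < 2^-1) (c12 : stat_close k l E1 E2).

Let k0 : 0 <= k. Proof. exact: le_trans ler01 k1. Qed.

(** [overshoot_deviation] applies to each of the two halves, whence the outer factor 2. It is used
    with [2 * k], since a reflected [yw_] is a difference of two statistics. All overshoots of [E1]
    at shifted thresholds are at most [s = SCDL_m E1 m]. *)
Lemma SCDL_m_deviation (m K : nat) theta : m = (2 ^ K)%N -> l * m%:R ^+ 2 <= 4 ->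
  0 < theta <= 1 ->
  SCDL_m E2 m <= SCDL_m E1 m + 2 * (4 * k * l * m%:R + 4 * k * Num.sqrt l
    + K%:R * (theta * SCDL_m E1 m + 4 * k ^+ 2 * l * m%:R / theta)).
Proof.
move=> mK lm t01; have m0 : (0 < m)%N by rewrite mK expn_gt0.
have t0 : 0 < theta by case/andP: t01.
have s0 := SCDL_m_ge0 E1 m; set s := SCDL_m E1 m in s0 *.
have lm0 : 0 <= l * m%:R by rewrite mulr_ge0// ltW.
have kx0 x : 0 <= x -> k * x <= 2 * k * x.
  by move=> x0; rewrite -mulrA -subr_ge0 (_ : _ - _ = k * x) ?mulr_ge0//; ring.
set err := (X in 2 * X).
have dev n (F1 F2 : (R * R -> R) -> R) : mean_functional F1 -> (n <= m)%N ->
    (forall j, (j < n)%N -> `|pi_ F2 m j - pi_ F1 m j|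
       <= 2 * k * (Num.sqrt (l * pi_ F1 m j) + l)) ->
    (forall j, (j < n)%N -> `|yw_ F2 m j - yw_ F1 m j|
       <= 2 * k * (Num.sqrt (l * pi_ F1 m j) + l)) ->
    (forall n', (n' <= n)%N -> overshoot F1 m n' <= s) ->
    overshoot F2 m n <= overshoot F1 m n + err.
  move=> hF nm d1 d2 os; case: n nm d1 d2 os => [|n] nm d1 d2 os.
    rewrite /overshoot !big_ord0 add0r /err !addr_ge0//.
    - by rewrite -mulrA mulr_ge0// mulr_ge0.
    - by rewrite mulr_ge0 ?sqrtr_ge0// mulr_ge0.
    - rewrite mulr_ge0// addr_ge0//; first by rewrite mulr_ge0 ?(ltW t0).
      by rewrite divr_ge0 ?(ltW t0)// -[leRHS]mulrA mulr_ge0// mulr_ge0// sqr_ge0.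
  have k20 : 0 <= 2 * k by rewrite mulr_ge0.
  have nK : (n.+1 <= 2 ^ K)%N by rewrite -mK.
  have a01 j : 0 <= pi_ F1 m j <= 1 by rewrite mass_ge0// mass_le1.
  apply: le_trans (overshoot_deviation (ltn0Sn n) nm nK k20 (ltW l0) t01 a01 d1 d2 os) _.
  have -> : 2 * (2 * k) * l * n.+1%:R = 4 * k * l * n.+1%:R by ring.
  have -> : 2 * (2 * k) * Num.sqrt l = 4 * k * Num.sqrt l by ring.
  have -> : (2 * k) ^+ 2 * l * m%:R = 4 * k ^+ 2 * l * m%:R by ring.
  rewrite lerD2l /err !lerD2r.
  by apply: ler_wpM2l; rewrite ?ler_nat// !mulr_ge0// ltW.
apply: SCDL_m_le => //.
  (* For empty sums [dev] says that [err] is nonnegative. *)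
  rewrite addr_ge0// mulr_ge0//; have := dev 0 E1 E1 hE1 (leq0n m).
  rewrite /overshoot !big_ord0 add0r; apply => // n'; rewrite leqn0 => /eqP ->.
  by rewrite big_ord0.
move=> i im; apply: le_trans (_ : _ <= (overshoot E1 m i.+1 + err)
    + (overshoot (refl_mean E1) m (m - i) + err)) _; last first.
  have := le_SCDL_m hE1 m0 (ltnW im); rewrite -/s; lra.
have r0 j : 0 <= Num.sqrt (l * pi_ E1 m j) + l.
  by rewrite addr_ge0 ?sqrtr_ge0// ltW.
apply: lerD; apply: dev => //.
- move=> j ji; have jm : (j <= m)%N by apply: leq_trans im; exact: ltnW.
  by have [h _] := c12 m0 jm lm; apply: le_trans h (kx0 _ (r0 j)).
- move=> j ji; have jm : (j <= m)%N by apply: leq_trans im; exact: ltnW.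
  by have [_ h] := c12 m0 jm lm; apply: le_trans h (kx0 _ (r0 j)).
- by move=> n' n'i; apply: (overshoot_le_SCDL_m hE1 m0 (leq_trans n'i im)).1.
- exact: mean_functional_refl.
- exact: leq_subr.
- move=> j ji; have jm : (j <= m)%N by apply: ltnW; apply: leq_trans ji (leq_subr _ _).
  rewrite !mass_refl//.
  by have [h _] := c12 m0 (leq_subr j m) lm; apply: le_trans h (kx0 _ (r0 _)).
- move=> j ji; have jm : (j <= m)%N by apply: ltnW; apply: leq_trans ji (leq_subr _ _).
  rewrite !yw_refl// mass_refl//; have [h h'] := c12 m0 (leq_subr j m) lm.
  set x := pi_ E1 m _; set y := yw_ E1 m _; set x' := pi_ E2 m _; set y' := yw_ E2 m _.
  have -> : x' - y' - (x - y) = (x' - x) + (y - y') by ring.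
  apply: le_trans (ler_normD _ _) _; rewrite -mulrA mulr2n mulrDl !mul1r.
  by apply: lerD => //; rewrite distrC.
- move=> n' n'i; apply: (overshoot_le_SCDL_m hE1 m0 _).2.
  exact: leq_trans n'i (leq_subr _ _).
Qed.

Lemma SCDL_deviation :
  SCDL E2 <= SCDL E1 + 30 * k ^+ 2 * (Num.sqrt l * ln l^-1).
Proof.
have kk : k <= k ^+ 2 by rewrite expr2 ler_peMl.
have r0 : 0 < Num.sqrt l by rewrite sqrtr_gt0.
have rl : l = Num.sqrt l ^+ 2 by rewrite sqr_sqrtr// ltW.
have L0 := ln_inv_ge l0 l2.
set r := Num.sqrt l in r0 rl *; set L := ln _ in L0 *.
(* If [r > 1/2] the claim is trivial: [SCDL E2 <= 1] while [r * L >= 1/4]. *)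
have [r2|r2] := leP r 2^-1; last first.
  apply: le_trans (SCDL_le1 hE2) _.
  have : 2^-1 * 2^-1 <= r * L by apply: ler_pM => //; lra.
  have : 1 * (r * L) <= k ^+ 2 * (r * L).
    by rewrite ler_wpM2r ?mulr_ge0 ?(ltW r0) ?expr_ge1//; lra.
  by have := SCDL_ge0 E1; rewrite -mulrA; lra.
have ri2 : 2 <= r^-1.
  by rewrite -[leLHS]invrK lef_pV2 ?posrE ?invr_gt0.
have [K [K0 Kle Klt]] := pow2_bracket ri2.
have ri0 : 0 < r^-1 by rewrite invr_gt0.
have KL : K%:R <= L.
  apply: le_trans (pow2_le_ln ri0 Kle) _.
  by rewrite /L rl -exprVn lnXn// mulr2n mulrDl mul1r.
have K1 : 1 <= K%:R :> R by rewrite ler1n.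
have rK n : (n <= K)%N -> r * (2 ^ n)%:R <= 1.
  move=> nK; rewrite -ler_pdivlMl// mulr1; apply: le_trans Kle.
  by rewrite ler_nat leq_exp2l.
pose err := (16 * k + 4 * K%:R + 8 * K%:R * k ^+ 2) * r.
have e4 : err = 2 * (4 * k * r + 4 * k * r + K%:R * (2 * r + 4 * k ^+ 2 * r)).
  by rewrite /err; ring.
(* With [theta = r * m], at most 1 on these grids, [theta * SCDL_m <= 2 r] and
   [4 k^2 l m / theta = 4 k^2 r]: every scale costs a multiple of [r]. *)
have direct n : (n < K)%N -> SCDL_m E1 (2 ^ n.+1) <= 2 / (2 ^ n.+1)%:R ->
    SCDL E2 <= Num.max (SCDL_m E1 (2 ^ n.+1)) (2 ^ n.+1)%:R^-1 + err.
  move=> nK; set m := (2 ^ n.+1)%N => s2.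
  have m0 : 0 < m%:R :> R by rewrite ltr0n expn_gt0.
  have rm1 : r * m%:R <= 1 by exact: rK.
  have rm0 : 0 < r * m%:R by rewrite mulr_gt0.
  have lm : l * m%:R ^+ 2 <= 4.
    rewrite rl -exprMn; apply: (@le_trans _ _ 1); last by rewrite ler1n.
    by rewrite expr_le1// ltW.
  have err0 : 0 <= err.
    by rewrite /err mulr_ge0 ?(ltW r0)// !addr_ge0 ?mulr_ge0// ?mulr_ge0// sqr_ge0.
  apply: le_trans (SCDL_le E2 n) _; rewrite ge_max -/m; apply/andP; split; last first.
    by apply: (@le_trans _ _ (Num.max (SCDL_m E1 m) m%:R^-1)); rewrite ?lerDl// le_max lexx orbT.
  apply: le_trans (_ : _ <= SCDL_m E1 m + err) _; last first.
    by rewrite lerD2r le_max lexx.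
  have t01 : 0 < r * m%:R <= 1 by rewrite rm0.
  apply: le_trans (SCDL_m_deviation erefl lm t01) _.
  rewrite lerD2l e4 ler_wpM2l// -/m; apply: lerD.
    rewrite lerD2r; have -> : 4 * k * l * m%:R = 4 * k * r * (r * m%:R).
      by rewrite [in LHS]rl; ring.
    by rewrite ler_piMr// !mulr_ge0// ltW.
  have -> : 4 * k ^+ 2 * l * m%:R / (r * m%:R) = 4 * k ^+ 2 * r.
    by rewrite [in LHS]rl; field; rewrite !gt_eqF.
  have s0 := SCDL_m_ge0 E1 m.
  have t2 : r * m%:R * SCDL_m E1 m <= 2 * r.
    apply: le_trans (ler_wpM2l (ltW rm0) s2) _.
    by rewrite le_eqVlt; apply/orP; left; apply/eqP; field; rewrite gt_eqF.
  have rk0 : 0 <= 4 * k ^+ 2 * r by rewrite !mulr_ge0 ?sqr_ge0// ltW.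
  apply: ler_pM => //; first by rewrite addr_ge0// mulr_ge0// ltW.
    by rewrite ler_nat.
  by rewrite lerD2r.
have step n : (n < K)%N -> SCDL E2 <= Num.max (SCDL_m E1 (2 ^ n.+1)) (2 ^ n.+1)%:R^-1 + err.
  elim: n => [|n IH] nK.
    apply: direct => //; rewrite expn1 divff// SCDL_m_le1//.
  (* If [SCDL_m > 2/m], halving [m] does not increase the maximum: [SCDL_m] decreases by
     monotonicity and the new [1/m] is the old [2/m]. The descent stops at [m = 2], where
     [2/m = 1]. *)
  have [|s2] := leP (SCDL_m E1 (2 ^ n.+2)) (2 / (2 ^ n.+2)%:R); first exact: direct.
  apply: le_trans (IH (ltnW nK)) _; rewrite lerD2r le_max ge_max.
  rewrite SCDL_m_pow_mono//=; apply/orP; left; apply: le_trans (ltW s2).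
  by rewrite (expnS 2 n.+1) natrM invfM mulrA divff// mul1r.
rewrite -lerBlDr; apply: le_SCDL => n; rewrite lerBlDr.
(* Here [1 <= K <= L], and [30 = 16 + 4 + 8 + 2]. *)
have err_le : err + 2 * r <= 30 * k ^+ 2 * (r * L).
  have -> : err + 2 * r = (16 * k + 4 * K%:R + 8 * (K%:R * k ^+ 2) + 2) * r.
    by rewrite /err; ring.
  rewrite [r * L]mulrC [leRHS]mulrA ler_wpM2r ?(ltW r0)//.
  have kk1 : 1 <= k ^+ 2 by rewrite expr_ge1.
  have kk0 : 0 <= k ^+ 2 by lra.
  have L1 : 1 <= L by exact: le_trans KL.
  have : k ^+ 2 <= k ^+ 2 * L by rewrite ler_peMr.
  have : L <= k ^+ 2 * L by rewrite ler_peMl//; lra.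
  have : K%:R * k ^+ 2 <= k ^+ 2 * L by rewrite mulrC ler_wpM2l.
  by rewrite -mulrA; lra.
have {}err_le x : SCDL E2 <= x + err + 2 * r -> SCDL E2 <= x + 30 * k ^+ 2 * (r * L).
  lra.
apply: err_le; have [nK|Kn] := ltnP n K.
  by apply: le_trans (step n nK) _; rewrite lerDl mulr_ge0// ltW.
(* Grids finer than [2^K] are replaced by [2^K]: [SCDL_m] does not increase, and [1/2^K < 2 r] is
   the extra error. *)
have KE : K.-1.+1 = K by rewrite prednK.
have := step K.-1; rewrite KE => /(_ (leqnn K))/le_trans; apply.
rewrite -addrA [err + _]addrC addrA lerD2r ge_max; apply/andP; split.
  apply: (@le_trans _ _ (Num.max (SCDL_m E1 (2 ^ n.+1)) (2 ^ n.+1)%:R^-1)); last first.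
    by rewrite lerDl mulr_ge0// ltW.
  by rewrite le_max SCDL_m_pow_mono// ltnW.
apply: le_trans (_ : 2 * r <= _); last first.
  by rewrite lerDr le_max SCDL_m_ge0.
rewrite -[leLHS]mul1r ler_pdivrMr ?ltr0n ?expn_gt0//.
by rewrite -mulrA mulrCA -ler_pdivrMl// mulr1 ltW.
Qed.

Lemma SCDL_deviation0 : SCDL E1 = 0 ->
  SCDL E2 <= 48 * k ^+ 2 * Num.sqrt (l * ln l^-1).
Proof.
move=> E10; have kk : k <= k ^+ 2 by rewrite expr2 ler_peMl.
have kk1 : 1 <= k ^+ 2 by rewrite expr_ge1.
have L0 := ln_inv_ge l0 l2; have L00 : 0 < ln l^-1 by lra.
have lL0 : 0 < l * ln l^-1 by rewrite mulr_gt0.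
(* A positive value at one grid would keep the infimum positive: finer grids have at least this
   [SCDL_m], coarser ones at least this [1/m]. *)
have s0 n : SCDL_m E1 (2 ^ n) = 0.
  apply/eqP; rewrite eq_le SCDL_m_ge0 andbT leNgt; apply/negP => sn.
  suff : Num.min (SCDL_m E1 (2 ^ n)) (2 ^ n)%:R^-1 <= SCDL E1.
    by rewrite E10 leNgt lt_min sn invr_gt0 ltr0n expn_gt0.
  apply: le_SCDL => i; rewrite ge_min !le_max.
  have [ni|ni] := leqP n i.+1; first by rewrite SCDL_m_pow_mono.
  apply/orP; right; apply/orP; right.
  by rewrite lef_pV2 ?posrE ?ltr0n ?expn_gt0// ler_nat leq_exp2l// ltnW.
set b := Num.sqrt _; have b0 : 0 < b by rewrite sqrtr_gt0.
have bb : b ^+ 2 = l * ln l^-1 by rewrite sqr_sqrtr// ltW.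
have [b2|b2] := leP b 2^-1; last first.
  apply: le_trans (SCDL_le1 hE2) _.
  have : b <= k ^+ 2 * b by rewrite ler_peMl// ltW.
  by rewrite -mulrA; lra.
have bi2 : 2 <= b^-1 by rewrite -[leLHS]invrK lef_pV2 ?posrE ?invr_gt0.
have [K [K0 Kle Klt]] := pow2_bracket bi2.
have bi0 : 0 < b^-1 by rewrite invr_gt0.
set m := (2 ^ K)%N in Kle Klt *.
have m0 : 0 < m%:R :> R by rewrite ltr0n expn_gt0.
have bm : b * m%:R <= 1 by rewrite -ler_pdivlMl// mulr1.
have lbb : l <= 2 * b ^+ 2.
  rewrite bb; have := ler_wpM2l (ltW l0) L0; lra.
have lm : l * m%:R <= 2 * b.
  apply: le_trans (_ : _ <= 2 * b * (b * m%:R)) _.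
    rewrite (_ : 2 * b * _ = 2 * b ^+ 2 * m%:R); last by ring.
    by rewrite ler_wpM2r// ltW.
  by rewrite ler_piMr// mulr_ge0// ltW.
have lm2 : l * m%:R ^+ 2 <= 4.
  apply: le_trans (_ : _ <= 2 * (b * m%:R) ^+ 2) _.
    by rewrite exprMn [leRHS]mulrA ler_wpM2r// sqr_ge0.
  have : (b * m%:R) ^+ 2 <= 1 by rewrite expr_le1// mulr_ge0// ltW.
  lra.
have sl : Num.sqrt l <= 2 * b.
  rewrite -[leRHS]ger0_norm ?mulr_ge0 ?(ltW b0)// -sqrtr_sqr ler_wsqrtr// exprMn.
  have -> : 2 ^+ 2 = 4 :> R by rewrite -natrX.
  have := sqr_ge0 b; lra.
(* [2 ln (1/b) = ln (b^-2)], where [b^-2 <= 2/l] and [2 < 1/l]. *)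
have KL : K%:R <= 2 * ln l^-1.
  have := pow2_le_ln bi0 Kle.
  have : ln (b^-1 ^+ 2) <= ln (2 / l).
    rewrite ler_ln ?posrE ?exprn_gt0 ?divr_gt0// exprVn.
    rewrite -[leRHS]invrK lef_pV2 ?posrE ?invr_gt0 ?divr_gt0 ?exprn_gt0//.
    rewrite invfM invrK; lra.
  rewrite lnXn// lnM ?posrE ?invr_gt0// mulr2n.
  have : ln 2 <= ln l^-1.
    by rewrite ler_ln ?posrE ?invr_gt0// -[leLHS]invrK lef_pV2 ?posrE ?invr_gt0// ltW.
  lra.
have Klm : K%:R * (l * m%:R) <= 2 * b.
  apply: le_trans (_ : _ <= 2 * b * (b * m%:R)) _; last first.
    by rewrite ler_piMr// mulr_ge0// ltW.
  rewrite (_ : 2 * b * _ = 2 * b ^+ 2 * m%:R); last by ring.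
  rewrite [leLHS]mulrA ler_wpM2r ?(ltW m0)// bb.
  by have := ler_wpM2r (ltW l0) KL; lra.
have KE : K.-1.+1 = K by rewrite prednK.
have b48 : 2 * b <= 48 * k ^+ 2 * b by rewrite ler_wpM2r ?(ltW b0)//; lra.
have := SCDL_le E2 K.-1; rewrite KE => /le_trans; apply.
rewrite ge_max; apply/andP; split; last first.
  apply: le_trans b48; rewrite -[leLHS]mul1r ler_pdivrMr//.
  by rewrite -mulrA mulrCA -ler_pdivrMl// mulr1 ltW.
(* As [SCDL_m E1 m = 0], the largest weight [theta = 1] is free. The three remaining terms are at
   most [8 k^2 b] each, and [48 = 2 * (8 + 8 + 8)]. *)
have t01 : 0 < (1 : R) <= 1 by rewrite ltr01 lexx.
apply: le_trans (SCDL_m_deviation erefl lm2 t01) _.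
rewrite s0 add0r mulr0 add0r divr1.
have := ler_wpM2l k0 lm; have := ler_wpM2l k0 sl.
have := ler_wpM2l (sqr_ge0 k) Klm.
have : k * b <= k ^+ 2 * b by rewrite ler_wpM2r// ltW.
rewrite (_ : 4 * k * l * m%:R = 4 * (k * (l * m%:R))); last by ring.
rewrite (_ : K%:R * (4 * k ^+ 2 * l * m%:R) = 4 * (k ^+ 2 * (K%:R * (l * m%:R)))); last by ring.
lra.
Qed.

End Close.
End Comparison.

(** * Concentration *)

Section Expectation.
Variable R : realType.

Lemma measurable_supp01 : measurable (@supp01 R).
Proof.
have -> : @supp01 R = (fst @^-1` [set` `[0, 1]%R]) `&` (snd @^-1` ([set 0] `|` [set 1])).
  apply/seteqP; split => z /=; rewrite in_itv /=.
    by move=> [z01 y01]; split.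
  by move=> [z01 y01]; split.
by apply: measurableI; rewrite -[X in measurable X]setTI;
  [apply: measurable_fst|apply: measurable_snd] => //; exact: measurableU.
Qed.

Variables (D : probability (R * R)%type R) (D01 : supported01 D).

Let mN : measurable (~` @supp01 R).
Proof. by apply: measurableC; exact: measurable_supp01. Qed.

Let DN : D (~` @supp01 R) = 0%E.
Proof.
by rewrite probability_setC ?[D _]D01 ?subee//; exact: measurable_supp01.
Qed.

Let TN : setT `\` ~` @supp01 R = @supp01 R.
Proof. by rewrite setTD setCK. Qed.

Lemma integrable_admissible f : admissible f -> D.-integrable setT (EFin \o f).
Proof.
move=> [mf [M Mf]]; have mEf := (measurable_EFinP _ _).2 mf.
rewrite (negligible_integrable mN)// TN; apply: measurable_bounded_integrable.
- exact: measurable_supp01.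
- by rewrite [X in (X < _)%E]D01 ltry.
- exact: measurable_funTS.
- exists M; split; first exact: num_real.
  by move=> y My z sz; apply: le_trans (ltW My); exact: Mf.
Qed.

Lemma mean_functional_expect : mean_functional (expect_of D).
Proof.
split.
- by move=> f g af ag; apply: RintegralD => //; exact: integrable_admissible.
- by move=> c f af; apply: RintegralZl => //; exact: integrable_admissible.
- move=> f g af ag fg; have iF := integrable_admissible af.
  have iG := integrable_admissible ag.
  (* The complement of the support is null, so both integrals restrict to the support, where the
     comparison is given. *)
  rewrite /expect_of /Rintegral (negligible_integral mN measurableT iF DN).
  rewrite (negligible_integral mN measurableT iG DN) TN.
  have mS := measurable_supp01.
  by apply: le_Rintegral => //; [exact: integrableS iF|exact: integrableS iG].
- rewrite /expect_of Rintegral_cst// mul1r.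
  exact: (congr1 fine (probability_setT D)).
Qed.

Lemma expect_indic B : measurable B -> expect_of D \1_B = fine (D B).
Proof. by move=> mB; rewrite /expect_of /Rintegral integral_indic// setIT. Qed.

End Expectation.

Section Empirical.
Variable R : realType.

Lemma mean_functional_empirical (T : nat) (x : 'I_T -> R * R) : (0 < T)%N ->
  (forall t, supp01 (x t)) -> mean_functional (empirical x).
Proof.
move=> T0 x01; have T0R : T%:R != 0 :> R by rewrite pnatr_eq0 -lt0n.
split.
- by move=> f g _ _; rewrite /empirical big_split mulrDr.
- by move=> c f _; rewrite /empirical -mulr_sumr mulrCA.
- move=> f g _ _ fg; rewrite /empirical ler_wpM2l ?invr_ge0//.
  by apply: ler_sum => t _; exact: fg.
- by rewrite /empirical sumr_const card_ord mulVf.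
Qed.

End Empirical.

(** * Bernstein-type tails for a finite product law *)

Section Chernoff.
Variable R : realType.

(** From [exp (-x) >= 1 - x], and [(1 + x + 2 x^2) (1 - x) = 1 + x^2 (1 - 2 x) >= 1]. *)
Lemma expR_le_quad (x : R) : x <= 2^-1 -> expR x <= 1 + x + 2 * x ^+ 2.
Proof.
move=> x2; have := expR_ge1Dx (- x); rewrite expRN => h.
have e0 := expR_gt0 x.
have := ler_wpM2l (ltW e0) h; rewrite mulfV ?gt_eqF// => h1.
have x1 : 0 < 1 + - x by lra.
rewrite -(ler_pM2r x1); apply: le_trans h1 _.
have : 0 <= x ^+ 2 * (1 - 2 * x) by rewrite mulr_ge0 ?sqr_ge0//; lra.
have -> : (1 + x + 2 * x ^+ 2) * (1 + - x) = 1 + x ^+ 2 * (1 - 2 * x) by ring.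
lra.
Qed.

Variables (T N : nat) (p g : 'I_N -> R).
Hypotheses (p0 : forall i, 0 <= p i) (p1 : \sum_i p i <= 1).
Hypothesis (g01 : forall i, 0 <= g i <= 1).
Let mu := \sum_i p i * g i.

(** Exponential Markov inequality. The tilt [s] may be negative, so that one statement serves both
    tails. *)
Lemma chernoff (s a : R) (P : pred {ffun 'I_T -> 'I_N}) : s <= 2^-1 ->
  (forall h, P h -> 0 <= s * (\sum_t g (h t) - T%:R * a)) ->
  \sum_(h | P h) \prod_t p (h t) <= expR (T%:R * (s * mu + 2 * s ^+ 2 * mu - s * a)).
Proof.
move=> s2 sP.
have mgf : \sum_i p i * expR (s * g i) <= expR (s * mu + 2 * s ^+ 2 * mu).
  apply: le_trans (_ : _ <= \sum_i (p i + s * (p i * g i) + 2 * s ^+ 2 * (p i * g i))) _.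
    apply: ler_sum => i _; have /andP[g0 g1] := g01 i.
    have sg : s * g i <= 2^-1.
      have [s0|s0] := leP 0 s; first by apply: le_trans s2; rewrite ler_piMr.
      by apply: (@le_trans _ _ 0) => //; rewrite nmulr_rle0.
    apply: le_trans (ler_wpM2l (p0 i) (expR_le_quad sg)) _.
    (* [g^2 <= g] bounds the second moment by the mean [mu], which gives deviations of order
       [sqrt (l * mu)]. *)
    have : 0 <= p i * s ^+ 2 * (g i * (1 - g i)).
      by rewrite mulr_ge0 ?(mulr_ge0 (p0 i) (sqr_ge0 s))// mulr_ge0// subr_ge0.
    have -> : p i * s ^+ 2 * (g i * (1 - g i)) =
      p i * (s ^+ 2 * g i) - p i * (s ^+ 2 * g i ^+ 2) by ring.
    have -> : p i * (1 + s * g i + 2 * (s * g i) ^+ 2) =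
      p i + s * (p i * g i) + 2 * (p i * (s ^+ 2 * g i ^+ 2)) by ring.
    have -> : 2 * s ^+ 2 * (p i * g i) = 2 * (p i * (s ^+ 2 * g i)) by ring.
    lra.
  rewrite !big_split /= -!mulr_sumr -/mu.
  by apply: le_trans _ (expR_ge1Dx _); have := p1; lra.
have mgf0 : 0 <= \sum_i p i * expR (s * g i).
  by apply: sumr_ge0 => i _; rewrite mulr_ge0// expR_ge0.
apply: le_trans (_ : _ <= \sum_(h : {ffun 'I_T -> 'I_N})
   expR (- (T%:R * (s * a))) * \prod_t (p (h t) * expR (s * g (h t)))) _.
  rewrite big_mkcond; apply: ler_sum => h _.
  have pp0 : 0 <= \prod_t p (h t) by apply: prodr_ge0.
  rewrite big_split /= -expR_sum; case: ifP => [Ph|_].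
    rewrite mulrCA ler_peMr// -expRD -[leLHS]expR0 ler_expR.
    by rewrite -mulr_sumr; have := sP _ Ph; lra.
  by rewrite !mulr_ge0 ?expR_ge0.
rewrite -mulr_sumr -(bigA_distr_bigA (fun _ i => p i * expR (s * g i))) /=.
rewrite prodr_const card_ord.
have -> : T%:R * (s * mu + 2 * s ^+ 2 * mu - s * a) =
   - (T%:R * (s * a)) + T%:R * (s * mu + 2 * s ^+ 2 * mu) by ring.
rewrite expRD ler_wpM2l ?expR_ge0// expRM_natl.
by apply: lerXn2r; rewrite ?nnegrE ?expR_ge0.
Qed.

(** For [mu >= 36 l] take [s = 3 sqrt (l / mu) <= 1/2]: the terms [18 l] and [-27 l] leave [-9 l].
    For smaller [mu] take [s = 1/2]: then [mu / 2 < 18 l], against [54 l / 2 = 27 l]. *)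
Lemma optimal_tilt (l : R) : 0 < l -> exists s, [/\ 0 <= s, s <= 2^-1 &
  2 * s ^+ 2 * mu - s * (9 * Num.sqrt (l * mu) + 54 * l) <= - (9 * l)].
Proof.
move=> l0; have mu0 : 0 <= mu.
  by apply: sumr_ge0 => i _; rewrite mulr_ge0//; case/andP: (g01 i).
have [m36|m36] := leP (36 * l) mu; last first.
  exists 2^-1; split => //; have := sqrtr_ge0 (l * mu).
  by rewrite (_ : 2 * 2^-1 ^+ 2 = 2^-1 :> R); [lra | field].
have mup : 0 < mu by apply: lt_le_trans m36; rewrite mulr_gt0.
set x := Num.sqrt l; set y := Num.sqrt mu.
have x0 : 0 < x by rewrite sqrtr_gt0.
have y0 : 0 < y by rewrite sqrtr_gt0.
have xx : l = x ^+ 2 by rewrite sqr_sqrtr// ltW.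
have yy : mu = y ^+ 2 by rewrite sqr_sqrtr.
have xy : 6 * x <= y.
  rewrite -[leLHS]ger0_norm ?mulr_ge0 ?(ltW x0)// -sqrtr_sqr ler_wsqrtr// exprMn -xx.
  by rewrite -natrX.
have -> : Num.sqrt (l * mu) = x * y by rewrite sqrtrM// ltW.
exists (3 * x / y); split.
- by rewrite divr_ge0 ?mulr_ge0// ltW.
- by rewrite ler_pdivrMr//; lra.
have : 0 <= 3 * x / y * (54 * l) by rewrite !mulr_ge0 ?invr_ge0// ltW.
have -> : 2 * (3 * x / y) ^+ 2 * mu = 18 * l by rewrite yy xx; field; lra.
have -> : 3 * x / y * (9 * (x * y) + 54 * l) = 27 * l + 3 * x / y * (54 * l).
  by rewrite xx; field; lra.
lra.
Qed.

Lemma upper_tail (l : R) : 0 < l ->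
  \sum_(h : {ffun 'I_T -> 'I_N} |
      T%:R * (mu + (9 * Num.sqrt (l * mu) + 54 * l)) <= \sum_t g (h t))
    \prod_t p (h t) <= expR (- (9 * l)) ^+ T.
Proof.
move=> l0; have [s [s0 s2 sl]] := optimal_tilt l0.
set r := _ + 54 * l in sl *.
apply: le_trans (chernoff (a := mu + r) s2 _) _.
  by move=> h hP; rewrite mulr_ge0// subr_ge0.
rewrite -expRM_natl ler_expR ler_wpM2l//; lra.
Qed.

Lemma lower_tail (l : R) : 0 < l ->
  \sum_(h : {ffun 'I_T -> 'I_N} |
      \sum_t g (h t) <= T%:R * (mu - (9 * Num.sqrt (l * mu) + 54 * l)))
    \prod_t p (h t) <= expR (- (9 * l)) ^+ T.
Proof.
move=> l0; have [s [s0 s2 sl]] := optimal_tilt l0.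
set r := _ + 54 * l in sl *.
have s2' : - s <= 2^-1 by lra.
apply: le_trans (chernoff (a := mu - r) s2' _) _.
  by move=> h hP; rewrite mulr_le0// ?oppr_le0// subr_le0.
rewrite -expRM_natl ler_expR ler_wpM2l// sqrrN; lra.
Qed.

End Chernoff.

Lemma measure_bigsetU_le d (U : measurableType d) (R : realType)
    (mu : {measure set U -> \bar R}) (I : Type) (r : seq I) (P : pred I) (F : I -> set U) :
  (forall i, measurable (F i)) ->
  (mu (\big[setU/set0]_(i <- r | P i) F i) <= \sum_(i <- r | P i) mu (F i))%E.
Proof.
move=> mF; elim: r => [|i r IH]; first by rewrite !big_nil measure0.
rewrite !big_cons; case: ifP => // _.
apply: le_trans (leeD2l _ IH); apply: measureU2 => //.
exact: bigsetU_measurable.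
Qed.

(** * Tail bound for one statistic of an i.i.d. sample *)

Section Sample.
Variable R : realType.
Variables (D : probability (R * R)%type R) (D01 : supported01 D).
Variables (T : nat) (T0 : (0 < T)%N).
Variables (d : measure_display) (Omega : measurableType d) (P : probability Omega R).
Variables (X : 'I_T -> Omega -> R * R) (XD : iid_sample P X D).

Let hD := mean_functional_expect D01.
Let T0R : 0 < T%:R :> R. Proof. by rewrite ltr0n. Qed.

Lemma iid_prob_bigcap (B : 'I_T -> set (R * R)) : (forall t, measurable (B t)) ->
  P (\bigcap_(t in [set: 'I_T]) (X t @^-1` B t)) = (\prod_t fine (D (B t)))%:E.
Proof.
have [mX [lawX indX]] := XD; move=> mB.
rewrite -[LHS]fineK; last first.
  apply: fin_num_measure; apply: fin_bigcap_measurable => // t _.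
  by rewrite -[X in measurable X]setTI; exact: mX.
rewrite indX//; congr EFin; apply: eq_bigr => t _.
by rewrite lawX.
Qed.

Section OneFunction.
Variable f : R * R -> R.
Hypotheses (mf : measurable_fun setT f) (f01 : forall z, supp01 z -> 0 <= f z <= 1).

(* Rounding [f] down to the grid [k / T] reduces the law of the sample to a finite product. *)
Let cell (k : 'I_T.+1) : set (R * R) :=
  f @^-1` [set` `[k%:R / T%:R, k.+1%:R / T%:R[%R].

Let mcell k : measurable (cell k).
Proof. by rewrite -[X in measurable X]setTI; apply: mf. Qed.

(** The index is the integer part of [T * f z]; the value [f z = 1] is the reason for [T + 1]
    cells. *)
Let cellP z : supp01 z -> exists k, forall k', cell k' z <-> k' = k.
Proof.
move=> /f01/andP[f0 f1]; have Tf0 : 0 <= T%:R * f z by rewrite mulr_ge0.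
have kT : (Num.truncn (T%:R * f z) < T.+1)%N.
  rewrite -(ltr_nat R); have /andP[h _] := truncn_itv Tf0.
  by apply: le_lt_trans h _; rewrite -natr1 ltr_pwDr// ler_piMr.
exists (Ordinal kT) => k'; rewrite /cell /= in_itv /= ler_pdivrMr// ltr_pdivlMr//.
rewrite ![f z * _]mulrC -truncn_eq//; split.
  by move=> /eqP e; apply: val_inj.
by move=> ->.
Qed.

Let p k := fine (D (cell k)).
Let g (k : 'I_T.+1) : R := k%:R / T%:R.

Let p_ge0 k : 0 <= p k. Proof. by rewrite fine_ge0. Qed.

Let g01 k : 0 <= g k <= 1.
Proof. by rewrite divr_ge0//= ler_pdivrMr// mul1r ler_nat -ltnS. Qed.

Let adm_indic k : admissible (\1_(cell k) : R * R -> R).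
Proof.
split; first exact: measurable_indic.
by exists 1 => z _; rewrite indicE; case: (_ \in _); rewrite ?normr0 ?normr1.
Qed.

Let sum_cell (c : 'I_T.+1 -> R) z k : (forall k', cell k' z <-> k' = k) ->
  \sum_k' c k' * \1_(cell k') z = c k.
Proof.
move=> kP; rewrite (bigD1 k)//= indicE mem_set ?mulr1; last by apply/kP.
rewrite big1 ?addr0// => k' /eqP k'k; rewrite indicE memNset ?mulr0//.
by move/kP.
Qed.

Let mean_cells (c : 'I_T.+1 -> R) :
  admissible (fun z => \sum_k c k * \1_(cell k) z) /\
  expect_of D (fun z => \sum_k c k * \1_(cell k) z) = \sum_k p k * c k.
Proof.
(* [mean_sum] takes families indexed by [nat], hence the extension by zero. *)
pose F n := if insub n is Some k then fun z => c k * \1_(cell k) z else fun=> 0 : R.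
have FE (k : 'I_T.+1) : F k = fun z => c k * \1_(cell k) z by rewrite /F valK.
have aF n : admissible (F n).
  by rewrite /F; case: insubP => [k _ _|_]; [exact: admissibleZ | exact: admissible_cst].
have [aS ES] := mean_sum hD T.+1 aF.
have eS : (fun z => \sum_(i < T.+1) F i z) = fun z => \sum_k c k * \1_(cell k) z.
  by apply/funext => z; apply: eq_bigr => k _; rewrite FE.
rewrite -eS; split => //; rewrite ES; apply: eq_bigr => k _.
by rewrite FE (mean_scale hD)// expect_indic// mulrC.
Qed.

Let sum_p : \sum_k p k <= 1.
Proof.
have [aS ES] := mean_cells (fun=> 1).
rewrite -[leRHS](mean_1 hD).
have -> : \sum_k p k = \sum_k p k * 1 by apply: eq_bigr => k _; rewrite mulr1.
rewrite -ES; apply: (mean_le hD) => //; first exact: admissible_cst.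
by move=> z /cellP[k kP]; rewrite (sum_cell _ kP).
Qed.

Let mu := \sum_k p k * g k.

Let adm_f : admissible f.
Proof.
by split => //; exists 1 => z /f01/andP[f0 f1]; rewrite ger0_norm.
Qed.

Let cell_bounds k z : cell k z -> g k <= f z <= g k + T%:R^-1.
Proof.
rewrite /cell /= in_itv /= => /andP[-> h] /=; apply: ltW; apply: lt_le_trans h _.
by rewrite /g -natr1 mulrDl mul1r.
Qed.

Let mu_le : mu <= expect_of D f.
Proof.
have [aS ES] := mean_cells g; rewrite /mu -ES; apply: (mean_le hD) => // z sz.
have [k kP] := cellP sz; rewrite (sum_cell _ kP).
by have /andP[] := cell_bounds ((kP k).2 erefl).
Qed.

Let mu_ge : expect_of D f - T%:R^-1 <= mu.
Proof.
have [aS ES] := mean_cells g; rewrite /mu -ES -[X in _ - X](mean_cst hD).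
rewrite lerBlDr -(mean_add hD)//; last exact: admissible_cst.
apply: (mean_le hD) => //; first exact: admissibleD aS (admissible_cst _).
move=> z sz; have [k kP] := cellP sz; rewrite (sum_cell _ kP).
by have /andP[] := cell_bounds ((kP k).2 erefl).
Qed.

(** [Bad] is the union of the product cells [C h] over the vectors [h] in either tail. Both the mean
    and the empirical mean are rounded down by at most [1/T], so the two errors do not add up. *)
Lemma sample_tail (l : R) : 0 < l -> exists Bad : set Omega,
  [/\ measurable Bad, (P Bad <= (2 * expR (- (9 * l)) ^+ T)%:E)%E &
    forall w, ~ Bad w -> (forall t, supp01 (X t w)) ->
      `|empirical (fun t => X t w) f - expect_of D f| <=
        9 * Num.sqrt (l * expect_of D f) + 54 * l + T%:R^-1].
Proof.
move=> l0; have [mX [lawX indX]] := XD.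
pose r := 9 * Num.sqrt (l * mu) + 54 * l.
pose up := [pred h : {ffun 'I_T -> 'I_T.+1} | T%:R * (mu + r) <= \sum_t g (h t)].
pose lo := [pred h : {ffun 'I_T -> 'I_T.+1} | \sum_t g (h t) <= T%:R * (mu - r)].
pose C (h : {ffun 'I_T -> 'I_T.+1}) : set Omega :=
  \bigcap_(t in [set: 'I_T]) (X t @^-1` cell (h t)).
have mC h : measurable (C h).
  apply: fin_bigcap_measurable => // t _.
  by rewrite -[X in measurable X]setTI; apply: mX.
have PC h : P (C h) = (\prod_t p (h t))%:E by rewrite iid_prob_bigcap.
have PU (Q : pred {ffun 'I_T -> 'I_T.+1}) :
    (P (\big[setU/set0]_(h | Q h) C h) <= (\sum_(h | Q h) \prod_t p (h t))%:E)%E.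
  apply: le_trans (measure_bigsetU_le P _ Q mC) _.
  by rewrite -sumEFin; apply: lee_sum => h _; rewrite -PC; exact: lexx.
exists (\big[setU/set0]_(h | up h) C h `|` \big[setU/set0]_(h | lo h) C h); split.
- by apply: measurableU; apply: bigsetU_measurable.
- apply: le_trans (_ : _ <= P (\big[setU/set0]_(h | up h) C h)
      + P (\big[setU/set0]_(h | lo h) C h))%E _.
    by apply: measureU2; apply: bigsetU_measurable.
  rewrite mulr2n mulrDl !mul1r EFinD; apply: leeD.
    by apply: le_trans (PU up) _; rewrite lee_fin; exact: upper_tail.
  by apply: le_trans (PU lo) _; rewrite lee_fin; exact: lower_tail.
move=> w nB sw; have hP t := cid (cellP (sw t)).
pose h := [ffun t => sval (hP t)].
have hc t : cell (h t) (X t w) by rewrite ffunE; apply/(svalP (hP t)).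
have Ch : C h w by move=> t _; exact: hc.
have nup : ~~ up h.
  apply/negP => uh; apply: nB; left.
  by rewrite -bigcup_seq_cond; exists h => //=; rewrite mem_index_enum.
have nlo : ~~ lo h.
  apply/negP => uh; apply: nB; right.
  by rewrite -bigcup_seq_cond; exists h => //=; rewrite mem_index_enum.
rewrite /= -!ltNge in nup nlo.
have rl : r <= 9 * Num.sqrt (l * expect_of D f) + 54 * l.
  by rewrite lerD2r ler_wpM2l// ler_wsqrtr// ler_wpM2l// ltW.
have e1 : T%:R^-1 * \sum_t g (h t) <= empirical (fun t => X t w) f.
  rewrite ler_wpM2l ?invr_ge0//; apply: ler_sum => t _.
  by have /andP[] := cell_bounds (hc t).
have e2 : empirical (fun t => X t w) f <= T%:R^-1 * \sum_t g (h t) + T%:R^-1.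
  have eT : T%:R^-1 * \sum_(t < T) T%:R^-1 = T%:R^-1 :> R.
    by rewrite sumr_const card_ord -[X in _ * X]mulr_natr mulVf ?mulr1// gt_eqF.
  rewrite -[X in _ + X]eT -mulrDr -big_split ler_wpM2l ?invr_ge0//; apply: ler_sum => t _ /=.
  by have /andP[] := cell_bounds (hc t).
move: nup nlo; rewrite -(ltr_pdivrMl _ _ T0R) -(ltr_pdivlMl _ _ T0R) => u1 u2.
have := mu_le; have := mu_ge; rewrite ler_norml; lra.
Qed.

End OneFunction.
End Sample.

(** * Union bound over all grids and bins *)

Section GoodEvent.
Variable R : realType.
Variables (D : probability (R * R)%type R) (D01 : supported01 D).
Variables (T : nat) (T2 : (2 <= T)%N).
Variables (d : measure_display) (Omega : measurableType d) (P : probability Omega R).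
Variables (X : 'I_T -> Omega -> R * R) (XD : iid_sample P X D).
Variable delta : R.
Hypothesis delta_lt : expR (- (T%:R / 2)) < delta < T%:R^-1.

Let T0 : (0 < T)%N. Proof. exact: leq_trans T2. Qed.
Let T0R : 0 < T%:R :> R. Proof. by rewrite ltr0n. Qed.
Let T2R : 2 <= T%:R :> R. Proof. by rewrite ler_nat. Qed.

Let d0 : 0 < delta.
Proof. by case/andP: delta_lt => h _; exact: lt_trans (expR_gt0 _) h. Qed.

Let Td : T%:R * delta < 1.
Proof. by case/andP: delta_lt => _ h; rewrite -ltr_pdivlMl// mulr1. Qed.

Let d2 : delta < 2^-1.
Proof.
case/andP: delta_lt => _ h; apply: lt_le_trans h _.
by rewrite lef_pV2 ?posrE.
Qed.

Let l := ln delta^-1 / T%:R.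

Lemma rate_gt0 : 0 < l.
Proof. by rewrite divr_gt0//; have := ln_inv_ge d0 d2; lra. Qed.

Lemma rate_lt : l < 2^-1.
Proof.
rewrite ltr_pdivrMr// lnV ?posrE//; case/andP: delta_lt => h _.
by move: h; rewrite -ltr_ln ?posrE ?expR_gt0// expRK; lra.
Qed.

Let rate_ge : T%:R^-1 <= 2 * l.
Proof.
rewrite /l mulrA ler_pdivlMr// mulVf ?gt_eqF//; have := ln_inv_ge d0 d2; lra.
Qed.

Let tailE : expR (- (9 * l)) ^+ T = delta ^+ 9.
Proof.
rewrite -expRM_natl /l (_ : _ * - _ = 9%:R * ln delta).
  by rewrite expRM_natl lnK.
by rewrite lnV ?posrE//; field; rewrite gt_eqF.
Qed.

(** The cap [l * m^2 <= 4] in [stat_close] implies [m <= 2 T], so indices below [M] cover all grids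
    and bins. *)
Let M := (2 * T).+1.
Let I := (bool * 'I_M * 'I_M)%type.

Let F (i : I) (z : R * R) : R :=
  let: (b, m, j) := i in if b then hatw m j z.1 else hatw m j z.1 * z.2.

Let mF i : measurable_fun setT (F i).
Proof.
case: i => [[[] m] j]; first exact: (admissible_hatw R m j).1.
exact: (admissible_hatwy R m j).1.
Qed.

Let F01 i z : supp01 z -> 0 <= F i z <= 1.
Proof.
case: i => [[[] m] j] /= [_ y01]; rewrite ?hatw_ge0 ?hatw_le1//.
by case: y01 => ->; rewrite ?mulr0 ?mulr1 ?lexx ?ler01// hatw_ge0 hatw_le1.
Qed.

(** There are [2 M^2] statistics. Two factors [delta] absorb [M^2], as [M * delta <= 5/2]; six more
    beat the constant, [25 / 2^6 <= 1]; one is left. *)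
Let tails_le : \sum_(i : I) 2 * delta ^+ 9 <= delta.
Proof.
have cI : #|{: I}| = (2 * (M * M))%N by rewrite !card_prod card_bool !card_ord mulnA.
rewrite sumr_const (_ : #|_| = (2 * (M * M))%N); last exact: cI.
rewrite -[leLHS]mulr_natr !natrM.
have Md : M%:R * delta <= 5 / 2.
  have : 2 * delta <= 1 by have := d2; lra.
  have : T%:R * delta < 1 by exact: Td.
  have -> : M%:R * delta = 2 * (T%:R * delta) + delta by rewrite /M -natr1 natrM; ring.
  by have := d2; lra.
have Md0 : 0 <= M%:R * delta by rewrite mulr_ge0// ltW.
have Md2 : (M%:R * delta) * (M%:R * delta) <= 5 / 2 * (5 / 2) by exact: ler_pM.
have d6 : delta ^+ 6 <= 2^-1 ^+ 6.
  by rewrite lerXn2r ?nnegrE ?(ltW d0)// ltW.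
have -> : 2 * delta ^+ 9 * (2 * (M%:R * M%:R)) =
  4 * (M%:R * delta * (M%:R * delta)) * delta ^+ 6 * delta by ring.
rewrite ler_piMl ?(ltW d0)//.
apply: le_trans (_ : _ <= 4 * (5 / 2 * (5 / 2)) * (2^-1 ^+ 6)) _; last by lra.
apply: ler_pM => //; first by rewrite mulr_ge0// mulr_ge0.
- by rewrite exprn_ge0// ltW.
- by rewrite ler_wpM2l.
Qed.

(** Besides the tail events, the null event that some sample point leaves the support is removed: on
    the rest the empirical mean is a [mean_functional]. *)
Lemma good_event : exists A : set Omega,
  [/\ measurable A, ((1 - delta)%:E <= P A)%E &
    forall w, A w -> mean_functional (empirical (fun t => X t w)) /\
      stat_close 56 l (expect_of D) (empirical (fun t => X t w))].
Proof.
have [mX [lawX _]] := XD; have l0 := rate_gt0.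
have hD := mean_functional_expect D01.
have tail i := cid (sample_tail D01 T0 XD (mF i) (@F01 i) l0).
pose Bad i := sval (tail i).
pose Off t := X t @^-1` (~` @supp01 R).
have mBad i : measurable (Bad i) by case: (svalP (tail i)).
have mOff t : measurable (Off t).
  by rewrite -[X in measurable X]setTI; apply: mX => //; apply: measurableC;
    exact: measurable_supp01.
have POff t : P (Off t) = 0%E.
  rewrite lawX; last by apply: measurableC; exact: measurable_supp01.
  by rewrite probability_setC ?[D _]D01 ?subee//; exact: measurable_supp01.
pose B := \big[setU/set0]_(t < T) Off t `|` \big[setU/set0]_(i : I) Bad i.
have mU : measurable (\big[setU/set0]_(t < T) Off t) by apply: bigsetU_measurable.
have mV : measurable (\big[setU/set0]_(i : I) Bad i) by apply: bigsetU_measurable.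
have mB : measurable B by apply: measurableU.
have PB : (P B <= delta%:E)%E.
  apply: le_trans (_ : _ <= P (\big[setU/set0]_(t < T) Off t)
      + P (\big[setU/set0]_(i : I) Bad i))%E _; first exact: measureU2.
  rewrite -[leRHS]add0e; apply: leeD.
    apply: le_trans (measure_bigsetU_le P _ xpredT mOff) _.
    by rewrite big1// => t _; exact: POff.
  apply: le_trans (measure_bigsetU_le P _ xpredT mBad) _.
  apply: le_trans (_ : _ <= \sum_(i : I) (2 * delta ^+ 9)%:E)%E _.
    by apply: lee_sum => i _; rewrite -tailE; case: (svalP (tail i)).
  by rewrite sumEFin lee_fin.
exists (~` B); split; first exact: measurableC.
  by rewrite probability_setC// EFinB; apply: leeB.
move=> w nB; have sw t : supp01 (X t w).
  apply: contrapT => nt; apply: nB; left.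
  by rewrite -bigcup_seq_cond; exists t => //=; rewrite mem_index_enum.
split; first exact: mean_functional_empirical.
(* [56 = 54 + 2]: the rounding error [1/T] is at most [2 l]. *)
have dev i : `|empirical (fun t => X t w) (F i) - expect_of D (F i)|
    <= 9 * Num.sqrt (l * expect_of D (F i)) + 56 * l.
  have [_ _ h] := svalP (tail i).
  have nbad : ~ Bad i w.
    move=> bi; apply: nB; right.
    by rewrite -bigcup_seq_cond; exists i => //=; rewrite mem_index_enum.
  by apply: le_trans (h w nbad sw) _; have := rate_ge; lra.
move=> m j m0 jm lm.
have mM : (m < M)%N.
  (* From [1/T <= 2 l] one gets [m^2 <= 8 T], which is at most [(2 T)^2] because [T >= 2]. *)
  rewrite ltnS -(ler_nat R) natrM -(@ler_pXn2r _ 2) ?nnegrE ?mulr_ge0//.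
  have : T%:R^-1 * m%:R ^+ 2 <= 2 * 4 :> R.
    apply: (@le_trans _ _ (2 * l * m%:R ^+ 2)).
      by rewrite ler_wpM2r ?sqr_ge0//; exact: rate_ge.
    by rewrite -mulrA ler_wpM2l.
  rewrite ler_pdivrMl// => /le_trans; apply.
  rewrite exprMn [T%:R ^+ 2]expr2 -natrX mulrCA ler_wpM2l// -natrM.
  have : 4 * 2 <= 4 * T%:R :> R by rewrite ler_wpM2l.
  rewrite natrM; lra.
have jM : (j < M)%N by exact: leq_ltn_trans mM.
have r (x : R) : 0 <= x -> x <= pi_ (expect_of D) m j ->
    9 * Num.sqrt (l * x) + 56 * l <= 56 * (Num.sqrt (l * pi_ (expect_of D) m j) + l).
  move=> x0 xp; have : Num.sqrt (l * x) <= Num.sqrt (l * pi_ (expect_of D) m j).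
    by rewrite ler_wsqrtr// ler_wpM2l// ltW.
  by have := sqrtr_ge0 (l * x); lra.
split.
  apply: le_trans (dev (true, Ordinal mM, Ordinal jM)) _.
  by apply: r => //; exact: (mass_ge0 hD).
apply: le_trans (dev (false, Ordinal mM, Ordinal jM)) _.
by apply: r; [exact: (yw_ge0 hD) | exact: (yw_le_mass hD)].
Qed.

End GoodEvent.

Theorem theorem7p1 :
  exists C : rat, 0 < C /\
  forall (R : realType) (D : probability (R * R)%type R), supported01 D ->
  forall (T : nat), (2 <= T)%N ->
  forall (d : measure_display) (Omega : measurableType d) (P : probability Omega R)
         (X : 'I_T -> Omega -> R * R), iid_sample P X D ->
  (forall delta : R, expR (- (T%:R / 2)) < delta < T%:R^-1 ->
     exists A : set Omega, measurable A /\ ((1 - delta)%:E <= P A)%E /\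
       A `<=` [set w | `| SCDL (empirical (fun t => X t w)) - SCDL (expect_of D) |
                        <= ratr C * Num.sqrt (ln delta^-1 / T%:R)
                           * ln (T%:R / ln delta^-1)]) /\
  (SCDL (expect_of D) = 0 ->
   forall delta : R, expR (- (T%:R / 2)) < delta < T%:R^-1 ->
     exists A : set Omega, measurable A /\ ((1 - delta)%:E <= P A)%E /\
       A `<=` [set w | SCDL (empirical (fun t => X t w))
                        <= ratr C * Num.sqrt (ln delta^-1 / T%:R
                                              * ln (T%:R / ln delta^-1))]).
Proof.
(* The largest constant required is [30 * (3 * 56^2)^2], about [2.7 * 10^9]; it comes from the
   comparison with the roles of the two functionals exchanged. *)
exists (10 ^+ 10); split=> //.
move=> R D D01 T T2 d Omega P X XD.
have hD := mean_functional_expect D01.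
have C10 : ratr (10 ^+ 10) = 10 ^+ 10 :> R by rewrite rmorphXn /= ratr_nat.
have C56 : 30 * (3 * 56 ^+ 2) ^+ 2 <= 10 ^+ 10 :> R by lra.
have C56' : 30 * 56 ^+ 2 <= 10 ^+ 10 :> R by lra.
have C56'' : 48 * 56 ^+ 2 <= 10 ^+ 10 :> R by lra.
have k56 : 1 <= 56 :> R by rewrite ler1n.
have k56' : 1 <= 3 * 56 ^+ 2 :> R by lra.
split=> [|D0] delta hdelta.
  have l0 := rate_gt0 T2 hdelta; have l2 := rate_lt T2 hdelta.
  have [A [mA PA Aw]] := good_event D01 T2 XD hdelta.
  exists A; split=> //; split=> // w /Aw[hS cDS] /=.
  rewrite C10 -[T%:R / _]invf_div; set l := _ / T%:R in l0 l2 cDS *.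
  have x0 : 0 <= Num.sqrt l * ln l^-1.
    by rewrite mulr_ge0 ?sqrtr_ge0//; have := ln_inv_ge l0 l2; lra.
  have cSD := stat_close_sym hD hS k56 (ltW l0) cDS.
  have := SCDL_deviation hD hS k56 l0 l2 cDS.
  have := SCDL_deviation hS hD k56' l0 l2 cSD.
  have := ler_wpM2r x0 C56; have := ler_wpM2r x0 C56'.
  by rewrite ler_norml -[10 ^+ 10 * _ * _]mulrA; lra.
have l0 := rate_gt0 T2 hdelta; have l2 := rate_lt T2 hdelta.
have [A [mA PA Aw]] := good_event D01 T2 XD hdelta.
exists A; split=> //; split=> // w /Aw[hS cDS] /=.
rewrite C10 -[T%:R / _]invf_div; set l := _ / T%:R in l0 l2 cDS *.
apply: le_trans (SCDL_deviation0 hD hS k56 l0 l2 cDS D0) _.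
by rewrite ler_wpM2r ?sqrtr_ge0.
Qed.
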